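(* Let $d\ge 2$ and let $C$ be a set of mutually touching cylinders in $\mathbb{R}^d$, with arbitrary (positive, possibly different) radii. Then $|C|\leq 20(d+1)\cdot 7^{2d-2}$.
   Context: For a line $L\subset\mathbb{R}^d$ and $r>0$, the (infinite circular) cylinder with axis $L$ and radius $r$ is the set of points of $\mathbb{R}^d$ at distance at most $r$ from $L$. Two cylinders with axes $L_1,L_2$ and radii $r_1,r_2$ touch if $\operatorname{dist}(L_1,L_2)=r_1+r_2$ (they are externally tangent: boundaries meet, interiors disjoint). A set of cylinders is mutually touching if every two distinct members touch. *)

(* Defs.v *)
From mathcomp Require Import all_boot all_order all_algebra.
From mathcomp Require Import all_classical all_reals.

Set Implicit Arguments.
Unset Strict Implicit.
Unset Printing Implicit Defensive.

Import Order.TTheory GRing.Theory Num.Theory.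
Local Open Scope classical_set_scope.
Local Open Scope ring_scope.

(* The library norm on ['rV[R]_d] is the sup norm, hence this definition. *)
Definition euclidean_norm (R : realType) (d : nat) (x : 'rV[R]_d) : R :=
  Num.sqrt (\sum_(i < d) x 0 i ^+ 2).

(* [inf] is a genuine infimum here as soon as [A] and [B] are nonempty. *)
Definition dist (R : realType) (d : nat) (A B : set 'rV[R]_d) : R :=
  inf [set euclidean_norm (a - b) | a in A & b in B].

Definition is_line (R : realType) (d : nat) (L : set 'rV[R]_d) : Prop :=
  exists p v : 'rV[R]_d, v != 0 /\ L = [set p + t *: v | t in [set: R]].

Definition cylinder (R : realType) (d : nat) (L : set 'rV[R]_d) (r : R) :
    set 'rV[R]_d :=
  [set x | dist [set x] L <= r].

Definition is_cylinder (R : realType) (d : nat) (A : set 'rV[R]_d) : Prop :=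
  exists (L : set 'rV[R]_d) (r : R), [/\ is_line L, 0 < r & A = cylinder L r].

(* For [2 <= d] the axis and the radius of a cylinder are determined by its
   set of points, so the existential quantifiers leave no choice. *)
Definition touch (R : realType) (d : nat) (A1 A2 : set 'rV[R]_d) : Prop :=
  exists (L1 L2 : set 'rV[R]_d) (r1 r2 : R),
    [/\ is_line L1, 0 < r1 & A1 = cylinder L1 r1] /\
    [/\ is_line L2, 0 < r2 & A2 = cylinder L2 r2] /\
    dist L1 L2 = r1 + r2.

Definition mutually_touching (R : realType) (d : nat)
    (C : set (set 'rV[R]_d)) : Prop :=
  forall A1 A2, C A1 -> C A2 -> A1 <> A2 -> touch A1 A2.

(* Main.v *)
Require Import Defs.
From mathcomp Require Import all_boot all_order all_algebra.
From mathcomp Require Import all_classical all_reals.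
From mathcomp Require Import topology normedtype derive realfun.
From mathcomp Require Import ring lra zify.

(** A generic choice of coordinates describes a cylinder by a point of [R^(2d-1)]:
    base point, direction and radius.  Tangency becomes a symmetric polynomial
    equation [F z w = 0] of degree 4 in each argument, which also holds on the
    diagonal, so it persists on [V * V], where [V] is the closure of the given
    points with respect to polynomials of degree at most 4.  Two nearby lines are
    at small distance, so near a point of [V] of positive radius every point of
    [V] has the same direction.  Let [g >= 0] be a polynomial of degree 8 with zero
    set [V].  Its perturbation
    [g + eps * sum_k z_k^8 / 8 + eta / radius] then has a local minimum near each
    direction occurring in the family.  The critical points solve a system
    [eps * z_k ^ m_k + q_k = 0] with [deg q_k <= m_k], where [m_k = 7] except for
    the radius, where [m_k = 9].  Outside finitely many [eps], monomials reduce
    modulo this system to those with all exponents below [m_k], so it has at most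
    [prod m_k = 9 * 7^(2d-2)] solutions.  Finally at most [d + 2] cylinders share
    a direction: the matrix [dist_ij^2 - (r_i + r_j)^2] is diagonal with negative
    entries, but its quadratic form vanishes at [c] as soon as
    [sum c_i = sum c_i r_i = 0] and [sum c_i p_i = 0]. *)

Set Implicit Arguments.
Unset Strict Implicit.
Unset Printing Implicit Defensive.

Import Order.TTheory GRing.Theory Num.Theory.
Import numFieldNormedType.Exports.

(** * Polynomial functions *)

Section PolynomialFunctions.
Local Open Scope ring_scope.
Variables (R : realType) (I : finType).
Implicit Types (a b : I -> nat) (z : I -> R) (f g : (I -> R) -> R).

Definition monom a z : R := \prod_i z i ^+ a i.

Definition peval (l : seq (R * (I -> nat))) z : R :=
  \sum_(t <- l) t.1 * monom t.2 z.

(** Polynomials are handled as functions: only values matter below, and the list may repeat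
    exponents. *)
Definition pdeg (k : nat) f : Prop :=
  exists2 l : seq (R * (I -> nat)),
    all (fun t => \sum_i t.2 i <= k)%N l & f =1 peval l.

Lemma pdegW k k' f : (k <= k')%N -> pdeg k f -> pdeg k' f.
Proof.
by move=> kk' [l lk fl]; exists l => //; apply: sub_all lk => t /leq_trans; exact.
Qed.

Lemma eq_pdeg k f g : f =1 g -> pdeg k f -> pdeg k g.
Proof. by move=> fg [l lk fl]; exists l => // z; rewrite -fg. Qed.

Lemma pdeg_monom k c a : (\sum_i a i <= k)%N -> pdeg k (fun z => c * monom a z).
Proof.
by move=> ak; exists [:: (c, a)]; rewrite /= ?ak // => z; rewrite /peval big_seq1.
Qed.

Lemma pdeg_cst k c : pdeg k (fun=> c).
Proof.
apply: (@eq_pdeg _ (fun z => c * monom (fun=> 0%N) z)).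
  by move=> z; rewrite /monom big1 ?mulr1 // => i _; rewrite expr0.
by apply: pdeg_monom; rewrite big1.
Qed.

Lemma monom1 i z : monom (fun j => (j == i) : nat) z = z i.
Proof.
rewrite /monom (bigD1 i) //= eqxx expr1 big1 ?mulr1 // => j /negbTE ->.
by rewrite expr0.
Qed.

Lemma pdeg_coord i : pdeg 1 (fun z => z i).
Proof.
apply: (@eq_pdeg _ (fun z => 1 * monom (fun j => (j == i) : nat) z)).
  by move=> z; rewrite mul1r monom1.
by apply: pdeg_monom; rewrite (bigD1 i) //= eqxx big1 // => j /negbTE ->.
Qed.

Lemma pdegD k f g : pdeg k f -> pdeg k g -> pdeg k (fun z => f z + g z).
Proof.
move=> [l lk fl] [l' lk' gl']; exists (l ++ l'); first by rewrite all_cat lk.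
by move=> z; rewrite fl gl' /peval big_cat.
Qed.

Lemma monomM a b z : monom a z * monom b z = monom (fun i => (a i + b i)%N) z.
Proof. by rewrite /monom -big_split; apply: eq_bigr => i _; rewrite exprD. Qed.

Lemma pdegM k k' f g :
  pdeg k f -> pdeg k' g -> pdeg (k + k') (fun z => f z * g z).
Proof.
move=> [l lk fl] [l' lk' gl'].
pose h (t t' : R * (I -> nat)) := (t.1 * t'.1, fun i => (t.2 i + t'.2 i)%N).
exists (allpairs h l l').
  elim: l lk {fl} => //= t l IH /andP[tk lk]; rewrite all_cat IH // andbT.
  rewrite all_map; apply: sub_all lk' => t' /= t'k'.
  by rewrite big_split leq_add.
move=> z; rewrite fl gl' /peval big_allpairs_dep big_distrl /=.
apply: eq_bigr => t _; rewrite big_distrr /=; apply: eq_bigr => t' _.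
by rewrite -monomM mulrACA.
Qed.

Lemma pdegN k f : pdeg k f -> pdeg k (fun z => - f z).
Proof.
move=> fk; apply: (@eq_pdeg _ (fun z => -1 * f z)); first by move=> z; rewrite mulN1r.
by have := pdegM (pdeg_cst 0 (-1)) fk.
Qed.

Lemma pdegB k f g : pdeg k f -> pdeg k g -> pdeg k (fun z => f z - g z).
Proof. by move=> fk gk; apply: pdegD => //; apply: pdegN. Qed.

Lemma pdegX k f n : pdeg k f -> pdeg (k * n) (fun z => f z ^+ n).
Proof.
move=> fk; elim: n => [|n IH]; first exact: pdeg_cst.
rewrite mulnS; apply: (@eq_pdeg _ (fun z => f z * f z ^+ n)).
  by move=> z; rewrite exprS.
exact: pdegM.
Qed.

Lemma pdeg_sum (J : Type) (s : seq J) (P : pred J) k (f : J -> (I -> R) -> R) :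
  (forall j, P j -> pdeg k (f j)) -> pdeg k (fun z => \sum_(j <- s | P j) f j z).
Proof.
move=> fk; elim: s => [|j s IH].
  by apply: (@eq_pdeg _ (fun=> 0)); [move=> z; rewrite big_nil|exact: pdeg_cst].
have [Pj|/negbTE Pj] := boolP (P j).
  apply: (@eq_pdeg _ (fun z => f j z + \sum_(j <- s | P j) f j z)).
    by move=> z; rewrite big_cons Pj.
  by apply: pdegD => //; apply: fk.
by apply: (eq_pdeg _ IH) => z; rewrite big_cons Pj.
Qed.

Lemma pdeg_prod (J : Type) (s : seq J) (P : pred J) (f : J -> (I -> R) -> R) :
  (forall j, P j -> pdeg 1 (f j)) ->
  pdeg (count P s) (fun z => \prod_(j <- s | P j) f j z).
Proof.
move=> fk; elim: s => [|j s IH] /=.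
  by apply: (@eq_pdeg _ (fun=> 1)); [move=> z; rewrite big_nil|exact: pdeg_cst].
have [Pj|/negbTE Pj] := boolP (P j).
  apply: (@eq_pdeg _ (fun z => f j z * \prod_(j <- s | P j) f j z)).
    by move=> z; rewrite big_cons Pj.
  by apply: pdegM => //; apply: fk.
by apply: (eq_pdeg _ IH) => z; rewrite big_cons Pj.
Qed.

Definition upd z i (x : R) : I -> R := fun j => if j == i then x else z j.

(** The partial derivative is recorded through the univariate restriction [p], the form in which the
    one-variable minimum criterion applies. *)
Lemma pdeg_deriv k f i : pdeg k f ->
  exists2 f', pdeg k.-1 f' &
    forall z, exists p : {poly R},
      (forall x, f (upd z i x) = p.[x]) /\ f' z = p^`().[z i].
Proof.
move=> [l lk fl].
pose lower a j := if j == i then (a i).-1 else a j.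
pose f' z := \sum_(t <- l) (t.1 *+ t.2 i) * monom (lower t.2) z.
exists f'.
  rewrite {}/f'; elim: l lk {fl} => [|t l IH] /=.
    by move=> _; apply: (@eq_pdeg _ (fun=> 0)); [move=> z; rewrite big_nil|exact: pdeg_cst].
  move=> /andP[tk /IH{}IH].
  apply: (@eq_pdeg _ (fun z => (t.1 *+ t.2 i) * monom (lower t.2) z +
     \sum_(t <- l) (t.1 *+ t.2 i) * monom (lower t.2) z)).
    by move=> z; rewrite big_cons.
  apply: pdegD => //.
  have [->|ti] := eqVneq (t.2 i) 0%N.
    by rewrite mulr0n; apply: (@eq_pdeg _ (fun=> 0)); [move=> z; rewrite mul0r|exact: pdeg_cst].
  apply: pdeg_monom; move: tk; rewrite !(bigD1 (P := xpredT) i) //= /lower eqxx.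
  have -> : (\sum_(j | j != i) (if j == i then (t.2 i).-1 else t.2 j) =
             \sum_(j | j != i) t.2 j)%N by apply: eq_bigr => j /negbTE ->.
  by move: (\sum_(_ | _) _)%N => S; lia.
move=> z.
exists (\sum_(t <- l) (t.1 * \prod_(j | j != i) z j ^+ t.2 j) *: 'X^(t.2 i)).
split=> [x|].
  rewrite fl /peval horner_sum; apply: eq_bigr => t _.
  rewrite !hornerE -mulrA; congr (_ * _).
  rewrite /monom (bigD1 i) //= {1}/upd eqxx mulrC; congr (_ * _).
  by apply: eq_bigr => j /negbTE ji; rewrite /upd ji.
rewrite raddf_sum /= horner_sum; apply: eq_bigr => t _.
rewrite derivZ derivXn !hornerE /= hornerMn hornerXn.
rewrite /monom (bigD1 i) //= /lower eqxx (eq_bigr (fun j => z j ^+ t.2 j)).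
  by rewrite -(mulr_natl t.1) -(mulr_natl (z i ^+ _)); ring.
by move=> j /negbTE ->.
Qed.

(** Bounding each exponent by [k] makes the index type finite; the tuples of total degree above [k]
    that come along get the value zero. *)
Definition tmonom k (a : {ffun I -> 'I_k.+1}) z : R :=
  if (\sum_i a i <= k)%N then monom (fun i => a i) z else 0.

Lemma pdeg_tmonom k (a : {ffun I -> 'I_k.+1}) : pdeg k (tmonom a).
Proof.
have [ak|/negbTE ak] := boolP (\sum_i a i <= k)%N; last first.
  by apply: (@eq_pdeg _ (fun=> 0)); [move=> z; rewrite /tmonom ak|exact: pdeg_cst].
apply: (@eq_pdeg _ (fun z => 1 * monom (fun i => a i) z)).
  by move=> z; rewrite /tmonom ak mul1r.
exact: pdeg_monom.
Qed.

Lemma pdeg_coef k f : pdeg k f ->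
  exists c : {ffun I -> 'I_k.+1} -> R, forall z, f z = \sum_a c a * tmonom a z.
Proof.
move=> [l lk fl].
suff [c Hc] : exists c : {ffun I -> 'I_k.+1} -> R,
    forall z, peval l z = \sum_a c a * tmonom a z.
  by exists c => z; rewrite fl.
elim: l lk {fl} => [_|t l IH /= /andP[tk /IH [c cE]]].
  by exists (fun=> 0) => z; rewrite /peval big_nil big1 // => a _; rewrite mul0r.
pose a0 : {ffun I -> 'I_k.+1} := [ffun i => inord (t.2 i)].
have a0E i : a0 i = t.2 i :> nat.
  rewrite ffunE inordK // ltnS (leq_trans _ tk) //.
  by rewrite (bigD1 i) //= leq_addr.
exists (fun a : {ffun I -> 'I_k.+1} => (if a == a0 then t.1 else 0) + c a) => z.
rewrite /peval big_cons; under [RHS]eq_bigr do rewrite mulrDl.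
rewrite big_split /= -cE; congr (_ + _).
rewrite (bigD1 a0) //= eqxx big1 ?addr0.
  rewrite /tmonom (eq_bigr t.2) ?tk //; congr (_ * _).
  by apply: eq_bigr => i _; rewrite a0E.
by move=> a /negbTE ->; rewrite mul0r.
Qed.

End PolynomialFunctions.

(** * Counting the solutions of a polynomial system *)

Section Bezout.
Local Open Scope ring_scope.
Variables (R : realType) (I : finType).

Lemma card_ord_lt k n : (#|[pred a : 'I_k | (a < n)%N]| <= n)%N.
Proof.
rewrite -[leqRHS](size_iota 0) cardE -(size_map val); apply: uniq_leq_size.
  by rewrite (map_inj_uniq val_inj) enum_uniq.
by move=> x /mapP[a]; rewrite mem_enum inE => an ->; rewrite mem_iota add0n.
Qed.

(** For each [k] other than [j] take the factor [z i - Z k i], with [i] a coordinate that separates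
    [Z k] from [Z j]; there are fewer than [n] factors. *)
Lemma interpolation n (Z : 'I_n -> I -> R) :
  (forall j k, j != k -> exists i, Z j i != Z k i) ->
  forall j, exists2 f, pdeg n f & f (Z j) != 0 /\ forall k, j != k -> f (Z k) = 0.
Proof.
move=> Zinj j.
have /choice[w wP] k : exists i : option I,
    if i is Some i then Z j i != Z k i else j == k.
  have [->|/Zinj[i ji]] := eqVneq j k; first by exists None.
  by exists (Some i).
pose h k z := if w k is Some i then z i - Z k i else 1.
exists (fun z => \prod_(k < n | k != j) h k z).
  apply: (@pdegW _ _ (count (fun k => k != j) (index_enum 'I_n))).
    by rewrite (leq_trans (count_size _ _)) // /index_enum -enumT size_enum_ord.
  apply: pdeg_prod => k _; rewrite /h.
  case: (w k) => [i|]; last exact: pdeg_cst.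
  by apply: pdegB; [exact: pdeg_coord|exact: pdeg_cst].
split.
  apply/prodf_neq0 => k kj; rewrite /h; have := wP k; case: (w k) => [i|].
    by rewrite subr_eq0.
  by rewrite oner_eq0.
move=> k jk; rewrite (bigD1 k) 1?eq_sym //= /h; have := wP k.
case: (w k) => [i _|]; first by rewrite subrr mul0r.
by rewrite (negbTE jk).
Qed.

Variables (m : I -> nat) (q : I -> (I -> R) -> R).
Hypothesis qdeg : forall i, pdeg (m i) (q i).

Let solution eps z := forall i, eps * z i ^+ m i + q i z = 0.

Let reduced k (a : {ffun I -> 'I_k.+1}) := [forall i, a i < m i]%N.

Lemma card_reduced k : (#|[pred a | @reduced k a]| <= \prod_i m i)%N.
Proof.
rewrite (@eq_card _ _ (family (fun i => [pred a : 'I_k.+1 | a < m i]%N))).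
  by rewrite card_family foldrE big_image /=; apply: leq_prod => i _; exact: card_ord_lt.
by move=> a; rewrite !inE; apply: eq_forallb => i.
Qed.

(** When [m i <= a i], the equation for [i] trades [eps * z i ^+ m i] for [- q i z] without raising
    the degree. The coefficients [c] depend neither on [eps] nor on the solution, so one matrix
    serves for all [eps]. *)
Lemma reduction k (a : {ffun I -> 'I_k.+1}) :
  exists c : {ffun I -> 'I_k.+1} -> R, forall eps z, solution eps z ->
    eps * tmonom a z + \sum_b c b * tmonom b z =
    eps * (if reduced a then tmonom a z else 0).
Proof.
have trivial : reduced a \/ ~~ (\sum_i a i <= k)%N ->
    exists c : {ffun I -> 'I_k.+1} -> R, forall eps z, solution eps z ->
      eps * tmonom a z + \sum_b c b * tmonom b z =
      eps * (if reduced a then tmonom a z else 0).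
  move=> ra; exists (fun=> 0) => eps z _.
  rewrite big1 ?addr0 => [|b _]; last by rewrite mul0r.
  by case: ra => [->//|/negbTE ak]; rewrite /tmonom ak if_same.
have [ra|nra] := boolP (reduced a); first by move: trivial; rewrite ra; apply; left.
have [ak|nak] := boolP (\sum_i a i <= k)%N; last first.
  by move: trivial; rewrite (negbTE nra); apply; right.
have /existsP[i] : [exists i, ~~ (a i < m i)%N] by rewrite -negb_forall.
rewrite -leqNgt => mi.
pose a' j := if j == i then (a i - m i)%N else a j.
have sa' : (\sum_j a j = \sum_j a' j + m i)%N.
  rewrite !(bigD1 (P := xpredT) i) //= /a' eqxx.
  have -> : (\sum_(j | j != i) (if j == i then (a i - m i)%N else a j) =
             \sum_(j | j != i) a j)%N by apply: eq_bigr => j /negbTE ->.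
  by move: (\sum_(_ | _) _)%N => S; lia.
have [|c cE] := @pdeg_coef R I k (fun z => (1 * monom a' z) * q i z).
  apply: (@pdegW _ _ (\sum_j a' j + m i)); first by rewrite -sa'.
  by apply: pdegM => //; exact: pdeg_monom.
exists c => eps z /(_ i) zi; rewrite -cE mulr0 /tmonom ak.
have -> : monom (fun j => a j) z = monom a' z * z i ^+ m i.
  rewrite /monom !(bigD1 (P := xpredT) i) //= /a' eqxx mulrAC -exprD subnK //.
  by congr (_ * _); apply: eq_bigr => j /negbTE ->.
by rewrite mul1r mulrCA -mulrDr zi mulr0.
Qed.

(** Let [M] hold the values of all monomials of degree at most [n] at the [n] points. The reductions
    read [(eps%:M + A) *m M = eps *: (S *m M')], where [M'] keeps the reduced rows only. If [eps] is
    no eigenvalue of [- A], the rank of [M] is at most the number of reduced exponents, while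
    interpolation forces it to be [n]. *)
Lemma few_solutions n : exists2 P : {poly R}, P != 0 &
  forall eps, ~~ root P eps -> forall Z : 'I_n -> I -> R,
    (forall j k, j != k -> exists i, Z j i != Z k i) ->
    (forall j, solution eps (Z j)) -> (n <= \prod_i m i)%N.
Proof.
pose X := {ffun I -> 'I_n.+1}.
have /choice[c cP] := @reduction n.
pose A := \matrix_(i < #|X|, j < #|X|) c (enum_val i) (enum_val j).
exists (char_poly (- A)); first by rewrite monic_neq0 ?char_poly_monic.
move=> eps; rewrite -eigenvalue_root_char negbK => /eqP ker0 Z Zinj Zsol.
have /choice[B BP] j : exists b : X -> R, (forall k, j != k ->
    \sum_a b a * tmonom a (Z k) = 0) /\ \sum_a b a * tmonom a (Z j) != 0.
  have [f /pdeg_coef[b bE] [fj fk]] := interpolation Zinj j.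
  by exists b; split=> [k jk|]; rewrite -bE // fk.
pose M := \matrix_(i < #|X|, j < n) tmonom (enum_val i) (Z j).
pose red : {pred X} := [pred a | reduced a].
pose S := \matrix_(i < #|X|, k < #|red|) ((enum_val i == enum_val k)%:R : R).
pose M' := \matrix_(k < #|red|, j < n) tmonom (enum_val k) (Z j).
have AM : (eps%:M + A) *m M = eps *: (S *m M').
  apply/matrixP => i j; rewrite mulmxDl mul_scalar_mx !mxE.
  have -> : \sum_k S i k * M' k j =
      if reduced (enum_val i) then tmonom (enum_val i) (Z j) else 0.
    case: ifP => ri.
      have rA : enum_val i \in red by [].
      rewrite (bigD1 (enum_rank_in rA (enum_val i))) //= !mxE enum_rankK_in // eqxx mul1r.
      rewrite big1 ?addr0 // => k ki; rewrite !mxE.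
      case: eqP => [ik|]; last by rewrite mul0r.
      by case/eqP: ki; apply: enum_val_inj; rewrite enum_rankK_in.
    rewrite big1 // => k _; rewrite !mxE; case: eqP => [ik|]; last by rewrite mul0r.
    by have : reduced (enum_val k) := enum_valP k; rewrite -ik ri.
  have <- := cP (enum_val i) eps (Z j) (Zsol j); congr (_ + _).
  rewrite [RHS](reindex_onto enum_val enum_rank) /=; last by move=> a _; rewrite enum_rankK.
  under [RHS]eq_bigl do rewrite enum_valK eqxx.
  by apply: eq_bigr => k _; rewrite !mxE.
have Aunit : eps%:M + A \in unitmx.
  have : row_free (- A - eps%:M) by rewrite -kermx_eq0 -[kermx _]/(eigenspace _ _) ker0.
  by rewrite row_free_unit -opprD -scaleN1r unitmxZ ?unitrN1 // addrC.
(* The rows of [Bm] are the coefficients of the interpolating polynomials, so [Bm *m M] is diagonal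
   with nonzero entries. *)
pose Bm := \matrix_(j < n, i < #|X|) B j (enum_val i).
have BM : Bm *m M \in unitmx.
  have -> : Bm *m M = diag_mx (\row_j (\sum_a B j a * tmonom a (Z j))).
    apply/matrixP => j k; rewrite !mxE.
    have -> : \sum_i Bm j i * M i k = \sum_a B j a * tmonom a (Z k).
      rewrite [RHS](reindex_onto enum_val enum_rank) /=; last by move=> a _; rewrite enum_rankK.
      under [RHS]eq_bigl do rewrite enum_valK eqxx.
      by apply: eq_bigr => i _; rewrite !mxE.
    by have [->|/(BP j).1 ->] := eqVneq j k; rewrite ?mulr1n ?mulr0n.
  rewrite unitmxE det_diag unitfE; apply/prodf_neq0 => j _; rewrite mxE.
  exact: (BP j).2.
have ME : M = invmx (eps%:M + A) *m (eps *: S) *m M'.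
  by rewrite -mulmxA -scalemxAl -AM mulKmx.
apply: leq_trans (card_reduced n); apply: (@leq_trans (\rank (Bm *m M))).
  by rewrite mxrank_unit.
rewrite ME !mulmxA; apply: leq_trans (mxrankM_maxr _ _) _; exact: rank_leq_row M'.
Qed.
End Bezout.

(** * Compact boxes and polynomial closure *)

Section Topology.
Local Open Scope classical_set_scope.
Local Open Scope ring_scope.
Variables (R : realType).

(** A nonzero [P] has fewer than [size P] roots, so one of [size P] distinct points of the interval
    is not a root. *)
Lemma nonroot_between (P : {poly R}) (a b : R) : P != 0 -> a < b ->
  exists t, [/\ a < t, t < b & ~~ root P t].
Proof.
move=> P0 ab.
pose s := [seq a + (b - a) / k.+2%:R | k <- iota 0 (size P)].
have ab0 : b - a != 0 by rewrite subr_eq0 gt_eqF.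
have us : uniq s.
  rewrite map_inj_uniq ?iota_uniq // => k l /addrI /(mulfI ab0) /invr_inj /eqP.
  by rewrite eqr_nat => /eqP [].
have [/(max_poly_roots P0)/(_ us)|] := boolP (all (root P) s).
  by rewrite size_map size_iota ltnn.
rewrite -has_predC => /hasP[_ /mapP[k _ ->] /= nr]; exists (a + (b - a) / k.+2%:R).
split=> //.
  by rewrite ltrDl divr_gt0 ?subr_gt0 // ltr0n.
rewrite -ltrBrDl ltr_pdivrMr ?ltr0n // ltr_pMr ?subr_gt0 //.
by rewrite ltr1n.
Qed.

Lemma poly_local_min (P : {poly R}) x0 e : 0 < e ->
  (forall x, `|x - x0| < e -> P.[x0] <= P.[x]) -> P^`().[x0] = 0.
Proof.
move=> e0 Pmin.
have x0e : x0 \in `](x0 - e), (x0 + e)[%R by rewrite in_itv /=; lra.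
have [_ <-] : is_derive x0 1 (horner P) 0.
  apply: (derive1_at_min _ _ x0e); first lra.
    by move=> t _; exact: derivable_horner.
  by move=> t; rewrite in_itv /= => /andP[te et]; apply: Pmin; rewrite ltr_norml; lra.
by have [_ ->] := is_derive_poly P x0.
Qed.

Lemma uniform_pos (J : finType) (Q : J -> R -> Prop) :
  (forall j, exists2 e, 0 < e & forall d, 0 < d < e -> Q j d) ->
  exists2 e, 0 < e & forall j d, 0 < d < e -> Q j d.
Proof.
move=> H; have /choice[e eP] j : exists e, 0 < e /\ forall d, 0 < d < e -> Q j d.
  by have [e] := H j; exists e.
(* The cap 1 covers an empty [J]. *)
exists (\big[Num.min/1]_j e j).
  by apply: lt_bigmin => // j _; have [] := eP j.
move=> j d /andP[d0 de]; have [_] := eP j; apply; rewrite d0 /=.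
apply: lt_le_trans de _; exact: bigmin_le_cond.
Qed.

Variable I : finType.
Local Notation space := (prod_topology (fun _ : I => R)).

Lemma ptws_coord_continuous (i : I) : continuous (fun z : space => z i).
Proof. exact: (@proj_continuous I (fun=> R) i). Qed.

Lemma space_ball (z0 : space) e : 0 < e ->
  \forall z \near z0, forall k, `|z k - z0 k| < e.
Proof.
move=> e0; apply: (@filter_forall _ _ (fun k => [set z : space | `|z k - z0 k| < e]) _
  (nbhs_filter z0)) => k.
have := @cvgr_dist_lt _ _ _ _ (nbhs_filter z0) _ _ (@ptws_coord_continuous k z0) _ e0.
by apply: filterS => z; rewrite distrC.
Qed.

(* Stated over an abstract space: unification diverges on the product topology. *)
Lemma peval_continuous (T : topologicalType) (c : I -> T -> R) l :
  (forall i, continuous (c i)) -> continuous (fun w => peval l (c^~ w)).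
Proof.
move=> cc; elim: l => [|t l IH].
  rewrite (_ : (fun _ => _) = (fun=> 0)); first exact: cst_continuous.
  by apply/funext => z; rewrite /peval big_nil.
rewrite (_ : (fun _ => _) = (fun w => t.1 * monom t.2 (c^~ w) + peval l (c^~ w))).
  move=> w; apply: cvgD; last exact: IH.
  apply: cvgM; first exact: cvg_cst.
  rewrite /monom; elim: (index_enum I) => [|i s IHs].
    by under eq_cvg do rewrite big_nil; rewrite big_nil; exact: cvg_cst.
  under eq_cvg do rewrite big_cons; rewrite big_cons.
  apply: cvgM; last exact: IHs.
  apply: (@continuous_comp _ _ _ (c i) (fun x => x ^+ t.2 i)); first exact: cc.
  exact: exprn_continuous.
by apply/funext => z; rewrite /peval big_cons.
Qed.

Lemma pdeg_continuous k (f : (I -> R) -> R) :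
  pdeg k f -> continuous (f : space -> R).
Proof.
move=> [l _ fl]; rewrite (_ : f = peval l); last by apply/funext.
exact: (@peval_continuous space (fun i z => z i) l ptws_coord_continuous).
Qed.

Definition box (lo hi : I -> R) : set space := [set z | forall i, lo i <= z i <= hi i].

Lemma box_compact lo hi : compact (box lo hi).
Proof.
have := @tychonoff I (fun=> R) (fun i => `[lo i, hi i]%classic) (fun i => @segment_compact R (lo i) (hi i)).
congr compact; apply/funext => z; apply/propext; split=> zb i; have := zb i.
Qed.

(** Compactness, as near covering, turns thresholds for [d] valid near each point into one for the
    whole box. *)
Lemma box_uniform lo hi (P : R -> (I -> R) -> Prop) :
  (forall z0, box lo hi z0 -> \forall z \near (z0 : space) & d \near 0^'+, P d z) ->
  exists2 e, 0 < e & forall d, 0 < d < e -> forall z, box lo hi z -> P d z.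
Proof.
move=> loc; have /compact_near_coveringP cov := @box_compact lo hi.
have [e /= e0 eP] : \forall d \near (0 : R)^'+, box lo hi `<=` P d by exact: cov.
exists e => // d /andP[d0 de] z bz.
by apply: (eP d) => //=; rewrite sub0r normrN gtr0_norm.
Qed.

(** The rows of [kermx E] span the coefficient vectors of the polynomials of degree at most [k] that
    vanish at all [x j]. The sum [g] of the squares of these generators vanishes exactly where all
    such polynomials do. *)
Lemma zariski_closure n (x : 'I_n -> I -> R) k : exists g,
  [/\ pdeg (k * 2) g, forall z, 0 <= g z, forall j, g (x j) = 0 &
    forall z, g z = 0 -> forall f, pdeg k f -> (forall j, f (x j) = 0) -> f z = 0].
Proof.
pose X := {ffun I -> 'I_k.+1}.
pose E := \matrix_(a < #|X|, j < n) tmonom (enum_val a) (x j).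
pose K := kermx E.
pose h i z := \sum_a K i a * tmonom (enum_val a) z.
have hx i j : h i (x j) = 0.
  have /matrixP/(_ i j) := mulmx_ker E; rewrite mxE [RHS]mxE => <-.
  by apply: eq_bigr => a _; rewrite [E _ _]mxE.
exists (fun z => \sum_i h i z ^+ 2); split.
- apply: pdeg_sum => i _; apply: pdegX; apply: pdeg_sum => a _.
  by have := pdegM (pdeg_cst _ 0 (K i a)) (pdeg_tmonom R (enum_val a)).
- by move=> z; apply: sumr_ge0 => i _; exact: sqr_ge0.
- by move=> j; apply: big1 => i _; rewrite hx expr0n.
move=> z /eqP; rewrite psumr_eq0 => [/allP hz f /pdeg_coef[c cE] fx|i _]; last exact: sqr_ge0.
have h0 i : h i z = 0.
  by have := hz i (mem_index_enum i); rewrite expf_eq0 => /eqP.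
have fE y : f y = \sum_(i < #|X|) c (enum_val i) * tmonom (enum_val i) y.
  rewrite cE [LHS](reindex_onto enum_val enum_rank) /=; last by move=> a _; rewrite enum_rankK.
  by under eq_bigl do rewrite enum_valK eqxx.
pose cr := \row_(i < #|X|) c (enum_val i).
have /submxP[D DE] : (cr <= K)%MS.
  apply/sub_kermxP/rowP => j; rewrite !mxE -[RHS](fx j) fE.
  by apply: eq_bigr => i _; rewrite !mxE.
rewrite fE (eq_bigr (fun i => \sum_l D 0 l * (K l i * tmonom (enum_val i) z))).
  rewrite exchange_big big1 //= => l _.
  by rewrite -big_distrr /= -[X in _ * X]/(h l z) h0 mulr0.
move=> i _; have := congr1 (fun v : 'rV_ _ => v 0 i) DE; rewrite mxE [RHS]mxE => ->.
by rewrite big_distrl /=; apply: eq_bigr => l _; rewrite mulrA.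
Qed.

End Topology.

(** * Critical points of the perturbed polynomial *)

Section Count.
Local Open Scope classical_set_scope.
Local Open Scope ring_scope.
Variables (R : realType).

Lemma compact_min (T : topologicalType) (A : set T) (f c : T -> R) (h : R) x0 :
  A x0 -> compact A -> continuous f -> continuous c -> (forall z, A z -> c z != 0) ->
  exists2 z, A z & forall w, A w -> f z + h / c z <= f w + h / c w.
Proof.
move=> Ax0 cA cf cc c0.
have [|z] := @compact_EVT_min T R (fun z => f z + h / c z) A (ex_intro _ x0 Ax0) cA.
  apply: continuous_in_subspaceT => z /set_mem Az.
  apply: cvgD; first exact: cf.
  apply: cvgM; first exact: cvg_cst.
  by apply: cvgV; [exact: c0|exact: cc].
by move=> /set_mem Az zmin; exists z => // w Aw; apply: zmin; exact/mem_set.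
Qed.

Let derivX8 (a x : R) : ((a / 8) *: 'X^8)^`().[x] = a * x ^+ 7.
Proof. by rewrite derivZ derivXn hornerZ hornerMn hornerXn -mulr_natr; field. Qed.

Variables (I : finType) (r : I) (U : pred I).
Hypothesis Ur : ~~ U r.

(** Differentiation in [z k] yields [z k ^+ 7], whose degree matches the bound 7 on the partial
    derivatives of [g]. *)
Definition penalty (z : I -> R) : R := \sum_k z k ^+ 8 / 8.

Lemma pdeg_penalty : pdeg 8 penalty.
Proof.
apply: pdeg_sum => k _; have := pdegM (pdegX 8 (pdeg_coord R k)) (pdeg_cst _ 0 8^-1).
by [].
Qed.

Lemma penalty_ge0 z : 0 <= penalty z.
Proof. by apply: sumr_ge0 => k _; rewrite divr_ge0 ?exprn_even_ge0. Qed.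

Lemma penalty_ge z k : z k ^+ 8 / 8 <= penalty z.
Proof.
rewrite /penalty (bigD1 k) //= lerDl.
by apply: sumr_ge0 => j _; rewrite divr_ge0 ?exprn_even_ge0.
Qed.

Lemma penalty_upd z k t : penalty (upd z k t) = t ^+ 8 / 8 + (penalty z - z k ^+ 8 / 8).
Proof.
rewrite /penalty !(bigD1 (P := xpredT) k) //= /upd eqxx addrAC subrr add0r.
by congr (_ + _); apply: eq_bigr => j /negbTE ->.
Qed.

Lemma upd_id (z : I -> R) k : upd z k (z k) = z.
Proof. by apply/funext => j; rewrite /upd; case: eqP => [->|]. Qed.

Variables (g : (I -> R) -> R) (g' : I -> (I -> R) -> R).
Hypothesis gdeg : pdeg 8 g.
Hypothesis g_ge0 : forall z, 0 <= g z.
Hypothesis g'P : forall k z, exists p : {poly R},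
  (forall t, g (upd z k t) = p.[t]) /\ g' k z = p^`().[z k].

(** Minimise [g + eps * penalty + eta / z r] over the box cut out by [M] and [d]. Every face costs
    more than the point [x]: [g] exceeds [c] where a coordinate in [U] is at distance [d], the term
    [eta / z r] is [eta * M] where [z r = M^-1], and [eps * penalty] exceeds [eta * M] where a
    coordinate has absolute value [M]. The minimum is thus interior, hence critical. *)
Lemma critical_point (M d eta eps c : R) (x : I -> R) :
  2 <= M -> 0 < d -> 0 < eta -> eta < eps < 2 * eta ->
  (forall k, `|x k| < M) -> M^-1 < x r -> g x = 0 ->
  2 * (penalty x + (x r)^-1) < M ->
  2 * eta * (penalty x + (x r)^-1) < c ->
  (forall z, (forall k, `|z k| <= M) -> M^-1 <= z r ->
    (forall k, U k -> `|z k - x k| <= d) ->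
    (exists2 k, U k & `|z k - x k| = d) -> c < g z) ->
  exists z, [/\ forall k, U k -> `|z k - x k| <= d,
    forall k, k != r -> eps * z k ^+ 7 + g' k z = 0 &
    eps * z r ^+ 9 + (z r ^+ 2 * g' r z - eta) = 0].
Proof.
move=> M2 d0 eta0 /andP[eta_eps eps_eta] xM xr gx0 qM qc gc.
have M0 : 0 < M by lra.
have Mi0 : 0 < M^-1 by rewrite invr_gt0.
have eps0 : 0 < eps by lra.
pose lo k := if k == r then M^-1 else if U k then Num.max (- M) (x k - d) else - M.
pose hi k := if U k then Num.min M (x k + d) else M.
have boxP z : box lo hi z <-> [/\ forall k, `|z k| <= M, M^-1 <= z r &
    forall k, U k -> `|z k - x k| <= d].
  split=> [bz|[zM zr zd] k].
    have zr : M^-1 <= z r by have := bz r; rewrite /lo eqxx => /andP[].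
    split=> // k.
      have := bz k; rewrite /lo /hi ler_norml; case: eqP => [->|_].
        by rewrite (negbTE Ur) => /andP[]; lra.
      by case: (U k); rewrite ?ge_max ?le_min; lra.
    move=> Uk; have := bz k; rewrite /lo /hi Uk; case: eqP => [kr|_].
      by move: Ur; rewrite -kr Uk.
    by rewrite ge_max le_min ler_norml; lra.
  have := zM k; rewrite /lo /hi ler_norml; case: eqP => [->|_].
    by rewrite (negbTE Ur) => /andP[]; lra.
  case: ifPn => [/zd|_]; last by [].
  by rewrite ge_max le_min ler_norml; lra.
have bx : box lo hi x.
  apply/boxP; split=> [k||k _]; [exact: ltW|exact: ltW|].
  by rewrite subrr normr0 ltW.
pose f z := g z + eps * penalty z.
have fdeg : pdeg 8 f.
  by apply: pdegD => //; have := pdegM (pdeg_cst _ 0 eps) pdeg_penalty.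
have [z /boxP[zM zr zd] zmin] := compact_min eta bx (@box_compact R I lo hi)
  (pdeg_continuous fdeg) (@ptws_coord_continuous R I r)
  (fun z bz => lt0r_neq0 (lt_le_trans Mi0 (let: And3 _ h _ := (boxP z).1 bz in h))).
have xr0 : 0 < (x r)^-1 by rewrite invr_gt0; lra.
have zr0 : 0 < z r by lra.
have zri0 : 0 < (z r)^-1 by rewrite invr_gt0.
(* Compare with [x], where [g] vanishes; both [eps] and [eta] are below [2 * eta]. *)
have ub : f z + eta / z r <= 2 * eta * (penalty x + (x r)^-1).
  apply: le_trans (zmin _ bx) _; rewrite /f gx0 add0r.
  have := penalty_ge0 x; nra.
have gz := g_ge0 z; have qz := penalty_ge0 z.
have zd' k : U k -> `|z k - x k| < d.
  move=> Uk; rewrite lt_neqAle zd // andbT; apply/eqP => zkd.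
  have := gc z zM zr zd (ex_intro2 _ _ k Uk zkd); move: ub; rewrite /f.
  have : 0 <= eps * penalty z by rewrite mulr_ge0 // ltW.
  have : 0 < eta / z r by rewrite divr_gt0.
  lra.
have etaM : 2 * eta * (penalty x + (x r)^-1) < eta * M by nra.
have zr' : M^-1 < z r.
  rewrite lt_neqAle zr andbT; apply/eqP => zrM; move: ub; rewrite /f -zrM invrK.
  have : 0 <= eps * penalty z by rewrite mulr_ge0 // ltW.
  lra.
have zM' k : `|z k| < M.
  rewrite lt_neqAle zM // andbT; apply/eqP => zkM; move: ub; rewrite /f.
  have := penalty_ge z k.
  have -> : z k ^+ 8 = M ^+ 8 by rewrite -zkM -normrX ger0_norm // exprn_even_ge0.
  (* This gives [M <= M ^+ 8 / 8]. *)
  have M7 : 8 <= M ^+ 7.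
    apply: (@le_trans _ _ (2 ^+ 7)); first lra.
    by rewrite lerXn2r // nnegrE; lra.
  have : 0 < eta / z r by rewrite divr_gt0.
  rewrite exprS => h1 h2 h3.
  have : M <= penalty z by nra.
  nra.
have near_box k : exists2 e, 0 < e & forall t, `|t - z k| < e -> box lo hi (upd z k t).
  pose e1 := M - `|z k|.
  pose e2 := if k == r then z r - M^-1 else 1.
  pose e3 := if U k then d - `|z k - x k| else 1.
  exists (Num.min e1 (Num.min e2 e3)).
    rewrite !lt_min /e1 /e2 /e3 subr_gt0 zM' /=.
    rewrite (fun_if (fun y => 0 < y)) (fun_if (fun y => 0 < y)) !subr_gt0 zr' ltr01 if_same /=.
    by case: ifP => // /zd'.
  move=> t; rewrite !lt_min => /and3P[t1 t2 t3]; apply/boxP; split=> [j||j Uj].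
  - rewrite /upd; case: eqP => // _.
    by have := ler_normD (t - z k) (z k); rewrite subrK; rewrite /e1 in t1; lra.
  - rewrite /upd; case: eqP => // kr; move: t2; rewrite /e2 kr eqxx.
    by rewrite ltr_norml; lra.
  - rewrite /upd; case: eqP => [jk|_]; last exact: zd.
    move: t3; rewrite /e3 -jk Uj.
    have := ler_normD (t - z j) (z j - x j).
    by rewrite (_ : t - z j + (z j - x j) = t - x j); [lra|ring].
exists z; split=> // [k kr|].
- have [e e0 eb] := near_box k; have [p [pg ->]] := g'P k z.
  have := @poly_local_min R (p + (eps / 8) *: 'X^8) (z k) e e0.
  rewrite derivD [(_^`() + _).[_]]hornerD derivX8 => H.
  rewrite addrC; apply: H => t /eb /zmin.
  rewrite /f penalty_upd -{1}(upd_id z k) !pg [upd z k t r]/upd eq_sym (negbTE kr).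
  by rewrite !hornerD !hornerZ !hornerXn; lra.
have [e e0 eb] := near_box r; have [p [pg ->]] := g'P r z.
pose s := p + (eps / 8) *: 'X^8.
have zrn0 : z r != 0 by rewrite gt_eqF.
have sE t : s.[t] = p.[t] + eps * (t ^+ 8 / 8) by rewrite /s hornerD hornerZ hornerXn; ring.
pose h := s.[z r] + eta / z r.
(* Near [z r] the function [s.[t] + eta / t - h] is nonnegative, and it is zero at [z r];
   multiplying it by [t] gives a polynomial [Q] with the same local minimum. *)
pose Q := 'X * (s - h%:P) + eta%:P.
have QE t : Q.[t] = t * (s.[t] - h) + eta.
  by rewrite !(hornerD, hornerM, hornerX, hornerN, hornerC).
have dQ : Q^`().[z r] = s.[z r] - h + z r * (p^`().[z r] + eps * z r ^+ 7).
  rewrite derivD derivC addr0 derivM derivX derivB derivC subr0 mul1r.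
  rewrite !(hornerD, hornerM, hornerX, hornerN, hornerC) /s derivD [(_^`() + _).[_]]hornerD.
  by rewrite derivX8.
have H : Q^`().[z r] = 0.
  apply: (@poly_local_min R Q (z r) (Num.min e (z r))); first by rewrite lt_min e0.
  move=> t; rewrite lt_min => /andP[/eb /zmin tmin].
  rewrite ltr_norml => /andP[t0 _].
  have {}t0 : 0 < t by lra.
  move: tmin; rewrite /f penalty_upd -{1}(upd_id z r) !pg [upd z r t r]/upd eqxx => tmin.
  rewrite !QE /h.
  have -> : z r * (s.[z r] - (s.[z r] + eta / z r)) + eta = 0 by field.
  have -> : t * (s.[t] - (s.[z r] + eta / z r)) + eta =
      t * (s.[t] + eta / t - (s.[z r] + eta / z r)) by field; rewrite ?zrn0 ?andbT gt_eqF.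
  by apply: mulr_ge0; [exact: ltW|rewrite subr_ge0 !sE; lra].
(* The factor [z r] clears the denominator of [eta / z r] contained in [h]. *)
have : z r * (s.[z r] - h + z r * (p^`().[z r] + eps * z r ^+ 7)) = 0.
  by rewrite -dQ H mulr0.
have -> : z r * (s.[z r] - h + z r * (p^`().[z r] + eps * z r ^+ 7)) =
  - eta + z r ^+ 2 * (p^`().[z r] + eps * z r ^+ 7) by rewrite /h; field.
by move=> <-; ring.
Qed.
End Count.

(** * Counting points separated in some of the coordinates *)

Section Count.
Local Open Scope classical_set_scope.
Local Open Scope ring_scope.
Variables (R : realType) (I : finType) (r : I) (U : pred I).
Hypothesis Ur : ~~ U r.
Local Notation space := (prod_topology (fun _ : I => R)).

Lemma pdeg_gt_near k (f : (I -> R) -> R) (z0 : space) c : pdeg k f -> c < f z0 ->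
  \forall z \near z0, c < f z.
Proof.
move=> /pdeg_continuous fc; exact: (@cvgr_gt _ _ _ (nbhs_filter z0) _ _ (fc z0) _).
Qed.

Lemma dist_lt_trans (a b c e d : R) : `|a - b| < e -> `|a - c| <= d -> `|b - c| < e + d.
Proof. by rewrite !ltr_norml ler_norml; lra. Qed.

Variables (F : (I -> R) -> (I -> R) -> R) (n : nat) (x : 'I_n -> I -> R).
Hypothesis F1deg : forall w, pdeg 4 (F^~ w).
Hypothesis F2deg : forall z, pdeg 4 (F z).
Hypothesis Fx : forall i j, F (x i) (x j) = 0.
Hypothesis xr : forall i, 0 < x i r.
Hypothesis xU : forall i j, i != j -> exists2 k, U k & x i k != x j k.
Hypothesis Floc : forall z0 : space, 0 < z0 r ->
  \forall z \near z0, F z z0 = 0 -> forall k, U k -> z k = z0 k.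

(** Each [x i] receives a neighbourhood, in the coordinates of [U], on whose boundary [g] is bounded
    below. The neighbourhoods are disjoint, so the critical points found in them are distinct, and
    [few_solutions] counts them. *)
Lemma separated_zeros : (n <= 9 * 7 ^ #|I|.-1)%N.
Proof.
have [g [gdeg g_ge0 gx gV]] := zariski_closure x 4.
(* Close up one argument at a time: first [F z (x j) = 0] for every zero [z] of [g], then
   [F z w = 0]. *)
have FV z w : g z = 0 -> g w = 0 -> F z w = 0.
  move=> gz gw; apply: (gV w gw _ (F2deg z)) => j.
  exact: (gV z gz _ (F1deg (x j))).
have /choice[g' g'P] k : exists f' : (I -> R) -> R, pdeg 7 f' /\
    forall z, exists p : {poly R}, (forall t, g (upd z k t) = p.[t]) /\ f' z = p^`().[z k].
  by have [f' f'deg f'P] := pdeg_deriv k gdeg; exists f'.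
pose q i := penalty (x i) + (x i r)^-1.
have xri i : 0 < (x i r)^-1 by rewrite invr_gt0.
have q0 i : 0 < q i by have := penalty_ge0 (x i); have := xri i; rewrite /q; lra.
pose M := 2 + \sum_i 2 * q i + \sum_i \sum_k `|x i k|.
have sq0 : 0 <= \sum_i 2 * q i by apply: sumr_ge0 => i _; rewrite mulr_ge0 // ltW.
have sx0 : 0 <= \sum_i \sum_k `|x i k|.
  by apply: sumr_ge0 => i _; apply: sumr_ge0.
have qM i : 2 * q i < M.
  have : 2 * q i <= \sum_i 2 * q i.
    by rewrite (bigD1 i) //= lerDl; apply: sumr_ge0 => j _; rewrite mulr_ge0 // ltW.
  by rewrite /M; lra.
have xM i k : `|x i k| < M.
  have : `|x i k| <= \sum_i \sum_k `|x i k|.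
    rewrite (bigD1 i) //= (bigD1 k) //= -addrA lerDl addr_ge0 ?sumr_ge0 // => j _.
    exact: sumr_ge0.
  by rewrite /M; lra.
have M2 : 2 <= M by rewrite /M; lra.
have M0 : 0 < M by lra.
have Mi0 : 0 < M^-1 by rewrite invr_gt0.
have xrM i : M^-1 < x i r.
  rewrite -[x i r]invrK ltf_pV2 ?posrE //.
  by have := qM i; have := penalty_ge0 (x i); have := xri i; rewrite /q; lra.
pose lo k := if k == r then M^-1 else - M.
pose hi (k : I) := M.
have boxr z : box lo hi z -> 0 < z r.
  by move=> /(_ r); rewrite /lo eqxx => /andP[+ _]; apply: lt_le_trans.
(* Near a point [z0] of the box there are three cases: [g z0] is positive, [z0] differs from [x i]
   on [U], or [z0] is a zero that agrees with [x i] on [U] and [Floc] applies. *)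
have [d1 d10 d1P] : exists2 e, 0 < e & forall i d, 0 < d < e ->
    forall z, box lo hi z -> g z = 0 -> (forall k, U k -> `|z k - x i k| <= d) ->
    forall k, U k -> z k = x i k.
  apply: uniform_pos => i; apply: box_uniform => z0 bz0.
  have [gz0|/eqP gz0] := pselect (g z0 = 0); last first.
    have gpos : 0 < g z0 by rewrite lt_neqAle eq_sym gz0 g_ge0.
    near=> z d => gz; have : 0 < g z by near: z; exact: pdeg_gt_near gdeg gpos.
    by rewrite gz ltxx.
  have [[k Uk zk]|zx] := pselect (exists2 k, U k & z0 k != x i k).
    have [D DE] : exists D, D = `|z0 k - x i k| by exists `|z0 k - x i k|.
    have D0 : 0 < D / 2 by rewrite DE divr_gt0 ?normr_gt0 ?subr_eq0.
    near=> z d.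
    have dD : d < D / 2 by near: d; exact: nbhs_right_lt.
    have /(_ k) zz0 : forall k', `|z k' - z0 k'| < D / 2.
      by near: z; exact: space_ball.
    move=> _ /(_ k Uk) zd; have : D < D / 2 + d by rewrite {1}DE; exact: dist_lt_trans zz0 zd.
    by move=> ?; exfalso; lra.
  near=> z d.
  have zP : F z z0 = 0 -> forall k, U k -> z k = z0 k by near: z; exact: Floc (boxr z0 bz0).
  move=> gz _ k Uk; rewrite (_ : x i k = z0 k); last first.
    by apply/eqP; apply/negPn/negP => zk; apply: zx; exists k; rewrite // eq_sym.
  exact: zP (FV _ _ gz gz0) k Uk.
(* The factor 2 keeps the neighbourhoods of different points disjoint. *)
have [d2 d20 d2P] : exists2 e, 0 < e & forall ij d, 0 < d < e -> ij.1 != ij.2 ->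
    exists2 k, U k & 2 * d < `|x ij.1 k - x ij.2 k|.
  apply: uniform_pos => -[i j] /=; have [->|/xU[k Uk xk]] := eqVneq i j; first by exists 1.
  exists (`|x i k - x j k| / 2); first by rewrite divr_gt0 ?normr_gt0 ?subr_eq0.
  by move=> d d0 _; exists k => //; lra.
pose d := Num.min d1 d2 / 2.
have dmin : 0 < Num.min d1 d2 by rewrite lt_min d10.
have dd1 : 0 < d < d1 by have := ge_min d1 d1 d2; rewrite lexx /= /d => ?; lra.
have dd2 : 0 < d < d2 by have := ge_min d2 d1 d2; rewrite lexx orbT /d => ?; lra.
have d0 : 0 < d by case/andP: dd1.
(* By the choice of [d1], no zero of [g] lies on the boundary of a neighbourhood, so compactness
   bounds [g] away from zero there. *)
have [c0 c00 c0P] : exists2 e, 0 < e & forall i c, 0 < c < e ->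
    forall z, box lo hi z -> (forall k, U k -> `|z k - x i k| <= d) ->
    (exists2 k, U k & `|z k - x i k| = d) -> c < g z.
  apply: uniform_pos => i; apply: box_uniform => z0 bz0.
  have [gz0|/eqP gz0] := pselect (g z0 = 0); last first.
    have gpos : 0 < g z0 / 2 by rewrite divr_gt0 // lt_neqAle eq_sym gz0 g_ge0.
    near=> z c.
    have cz : c < g z0 / 2 by near: c; exact: nbhs_right_lt.
    have gz : g z0 / 2 < g z by near: z; apply: pdeg_gt_near gdeg _; lra.
    by move=> _ _; exact: lt_trans gz.
  have [zd|] := pselect (forall k, U k -> `|z0 k - x i k| <= d).
    have zx := d1P i d dd1 z0 bz0 gz0 zd.
    near=> z c.
    have zz0 : forall k, `|z k - z0 k| < d by near: z; exact: space_ball.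
    by move=> _ [k Uk]; have := zz0 k; rewrite zx // => /lt_eqF/eqP.
  move=> /existsNP[k /not_implyP[Uk /negP]]; rewrite -ltNge => zk.
  have zk0 : 0 < `|z0 k - x i k| - d by rewrite subr_gt0.
  near=> z c.
  have : forall k', `|z k' - z0 k'| < `|z0 k - x i k| - d by near: z; exact: space_ball.
  move=> /(_ k) zz0 /(_ k Uk) zd; have := dist_lt_trans zz0 zd.
  by rewrite subrK ltxx.
pose c := c0 / 2.
have cc0 : 0 < c < c0 by rewrite /c; lra.
pose eta := c / M / 2.
have eta0 : 0 < eta by case/andP: cc0 => ? _; rewrite /eta !divr_gt0.
have etaq i : 2 * eta * q i < c.
  have -> : c = 2 * eta * M by rewrite /eta; field; lra.
  by rewrite ltr_pM2l; have := qM i; have := q0 i; lra.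
(* For [r] the derivative is multiplied by [z r ^+ 2], hence 9. *)
pose m k := (if k == r then 9 else 7)%N.
pose h k (z : I -> R) := if k == r then z r ^+ 2 * g' r z - eta else g' k z.
have hdeg k : pdeg (m k) (h k).
  rewrite /m /h; case: eqP => _; last exact: (g'P k).1.
  apply: pdegB; last exact: pdeg_cst.
  have := pdegM (pdegX 2 (pdeg_coord R r)) (g'P r).1; exact.
have [P P0 PP] := few_solutions hdeg n.
have [|eps [eps1 eps2 nr]] := @nonroot_between R P eta (2 * eta) P0; first by lra.
have /choice[Z ZP] i : exists z : I -> R, (forall k, U k -> `|z k - x i k| <= d) /\
    forall k, eps * z k ^+ m k + h k z = 0.
  have [||z [zd zk zr]] := @critical_point R I r U Ur g g' gdeg g_ge0
    (fun k z => (g'P k).2 z) M d eta eps c (x i) M2 d0 eta0 _ (xM i) (xrM i) (gx i)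
    (qM i) (etaq i).
  - by rewrite eps1.
  - move=> z zM zr; apply: (c0P i c cc0) => k; have := zM k.
    rewrite ler_norml /lo /hi => /andP[z1 z2]; rewrite z2 andbT.
    by case: eqP => [->|].
  exists z; split=> // k; rewrite /m /h; case: eqP => [->|/eqP] //; exact: zk.
apply: leq_trans (PP eps nr Z _ _) _.
- move=> i j ij; have [k Uk /= xk] := d2P (i, j) d dd2 ij; exists k.
  apply/eqP => Zk; have Zi := (ZP i).1 k Uk; have := (ZP j).1 k Uk; rewrite -Zk => Zj.
  have := @dist_lt_trans (Z i k) (x i k) (x j k) (`|x i k - x j k| - d) d.
  by move=> /(_ _ Zj); lra.
- by move=> j; exact: (ZP j).2.
rewrite (bigD1 r) //= /m eqxx leq_mul2l /=.
rewrite (eq_bigr (fun=> 7%N)) => [|k /negbTE ->//].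
by rewrite prod_nat_const cardC1.
Unshelve. all: by end_near. Qed.
End Count.

(** * Lines and cylinders *)

Section Euclid.
Local Open Scope classical_set_scope.
Local Open Scope ring_scope.
Variables (R : realType) (d : nat).
Implicit Types u v w p q x y : 'rV[R]_d.

Definition dot u v : R := \sum_i u 0 i * v 0 i.

Lemma dotC u v : dot u v = dot v u.
Proof. by apply: eq_bigr => i _; rewrite mulrC. Qed.

Lemma dotDl u v w : dot (u + v) w = dot u w + dot v w.
Proof. by rewrite -big_split; apply: eq_bigr => i _; rewrite mxE mulrDl. Qed.

Lemma dotZl a u w : dot (a *: u) w = a * dot u w.
Proof. by rewrite /dot big_distrr; apply: eq_bigr => i _; rewrite mxE /= mulrA. Qed.

Lemma dotNl u w : dot (- u) w = - dot u w.
Proof. by rewrite -scaleN1r dotZl mulN1r. Qed.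

Lemma dotDr u v w : dot w (u + v) = dot w u + dot w v.
Proof. by rewrite dotC dotDl !(dotC w). Qed.

Lemma dotZr a u w : dot w (a *: u) = a * dot w u.
Proof. by rewrite dotC dotZl dotC. Qed.

Lemma dotNr u w : dot w (- u) = - dot w u.
Proof. by rewrite dotC dotNl dotC. Qed.

Definition dotE := (dotDl, dotDr, dotZl, dotZr, dotNl, dotNr).

Lemma dot_ge0 u : 0 <= dot u u.
Proof. by apply: sumr_ge0 => i _; rewrite -expr2 sqr_ge0. Qed.

Lemma dot_eq0 u : (dot u u == 0) = (u == 0).
Proof.
apply/idP/eqP => [|->]; last by rewrite /dot big1 // => i _; rewrite mxE mul0r.
rewrite psumr_eq0 => [/allP u0|i _]; last by rewrite -expr2 sqr_ge0.
apply/rowP => i; rewrite mxE; apply/eqP.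
by have := u0 i (mem_index_enum i); rewrite mulf_eq0 orbb.
Qed.

Lemma dot_gt0 u : (0 < dot u u) = (u != 0).
Proof. by rewrite lt_neqAle dot_ge0 andbT eq_sym dot_eq0. Qed.

Lemma euclidean_normE u : euclidean_norm u = Num.sqrt (dot u u).
Proof. by congr Num.sqrt; apply: eq_bigr => i _; rewrite expr2. Qed.

(** The Gram determinant of two vectors: the squared area of their parallelogram. *)
Definition cross u v : R := dot u u * dot v v - dot u v ^+ 2.

Lemma cross_ge0 u v : 0 <= cross u v.
Proof.
have [->|u0] := eqVneq u 0.
  by rewrite /cross -(scale0r v) !dotE !mul0r expr0n subrr.
have := dot_ge0 (dot u u *: v - dot u v *: u).
have -> : dot (dot u u *: v - dot u v *: u) (dot u u *: v - dot u v *: u) =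
    dot u u * cross u v by rewrite !dotE (dotC v u) /cross; ring.
by rewrite pmulr_rge0 // dot_gt0.
Qed.

Lemma cross_eq0 u v : cross u v = 0 -> dot u u *: v = dot u v *: u.
Proof.
move=> c0; apply/eqP; rewrite -subr_eq0 -dot_eq0 !dotE (dotC v u); apply/eqP.
transitivity (dot u u * cross u v); last by rewrite c0 mulr0.
by rewrite /cross; ring.
Qed.

Definition line p v : set 'rV[R]_d := [set p + t *: v | t in [set: R]].

Lemma eq_line p v q w a : a != 0 -> v = a *: w -> line p v q -> line p v = line q w.
Proof.
move=> a0 -> [b _ <-]; apply/seteqP; split=> _ [t _ <-].
  exists ((t - b) * a) => //; rewrite !scalerA -addrA -scalerDl; congr (_ + _ *: _).
  by ring.
exists (b + t / a) => //; rewrite !scalerA -addrA -scalerDl; congr (_ + _ *: _).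
by field.
Qed.

(** The Gram determinant of three vectors: the squared volume of their parallelepiped. *)
Definition gram w u v : R :=
  dot w w * cross u v - dot w u ^+ 2 * dot v v - dot w v ^+ 2 * dot u u
  + 2 * dot w u * dot w v * dot u v.

Lemma inf_attained (A : set R) (x : R) : A x -> (forall y : R, A y -> x <= y) -> inf A = x.
Proof.
move=> Ax xlb; apply/eqP; rewrite eq_le; apply/andP; split.
  by apply: ge_inf => //; exists x => z; exact: xlb.
by apply: lb_le_inf; [exists x|exact: xlb].
Qed.

(** Volume is base area times height. For parallel lines both sides vanish and the equation says
    nothing about [r]. *)
Lemma dist_line p u q v r : u != 0 -> v != 0 -> dist (line p u) (line q v) = r ->
  gram (p - q) u v = r ^+ 2 * cross u v.
Proof.
move=> u0 v0; have a0 : 0 < dot u u by rewrite dot_gt0.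
have b0 : 0 < dot v v by rewrite dot_gt0.
have [w wE] : exists w, w = p - q by exists (p - q).
rewrite -wE => dr.
have [c0|/eqP c0] := pselect (cross u v = 0).
  rewrite c0 mulr0; have /(congr1 (dot w)) := cross_eq0 c0; rewrite !dotZr => wvu.
  have ab : dot u u * dot v v = dot u v ^+ 2 by apply/eqP; rewrite -subr_eq0 -/(cross u v) c0.
  apply/eqP; rewrite -(mulrI_eq0 _ (lregP (lt0r_neq0 a0))) /gram c0; apply/eqP.
  transitivity (- dot w u ^+ 2 * (dot u u * dot v v) - (dot u u * dot w v) ^+ 2 +
    2 * dot w u * (dot u u * dot w v) * dot u v); first by ring.
  by rewrite wvu ab; ring.
have {}c0 : 0 < cross u v by rewrite lt_neqAle eq_sym c0 cross_ge0.
pose N s t := dot (w + s *: u - t *: v) (w + s *: u - t *: v).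
have NE s t : p + s *: u - (q + t *: v) = w + s *: u - t *: v.
  by rewrite wE opprD addrACA addrA.
(* The parameters of the two nearest points, by Cramer's rule. *)
pose s0 := (dot u v * dot w v - dot v v * dot w u) / cross u v.
pose t0 := (dot u u * dot w v - dot u v * dot w u) / cross u v.
have NE0 : N s0 t0 = gram w u v / cross u v.
  rewrite /N !dotE !(dotC u w) !(dotC v w) !(dotC v u) /s0 /t0 /gram.
  move: c0; rewrite /cross => c0; field; lra.
have Nmin s t : N s0 t0 <= N s t.
  rewrite NE0 ler_pdivrMr // -subr_ge0.
  set X := dot w u + s * dot u u - t * dot u v.
  set Y := dot w v - t * dot v v + s * dot u v.
  rewrite -(pmulr_rge0 _ a0).
  have -> : dot u u * (N s t * cross u v - gram w u v) =
      (dot u u * Y - dot u v * X) ^+ 2 + cross u v * X ^+ 2.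
    rewrite /N /X /Y !dotE !(dotC u w) !(dotC v w) !(dotC v u) /gram /cross; ring.
  by rewrite addr_ge0 ?sqr_ge0 // mulr_ge0 ?sqr_ge0 // ltW.
have rE : r = Num.sqrt (N s0 t0).
  rewrite -dr; apply: inf_attained.
    exists (p + s0 *: u); first by exists s0.
    exists (q + t0 *: v); first by exists t0.
    by rewrite euclidean_normE NE.
  move=> _ [_ [s _ <-] [_ [t _ <-] <-]]; rewrite euclidean_normE NE.
  by rewrite ler_sqrt ?dot_ge0 //; exact: Nmin.
rewrite rE sqr_sqrtr ?dot_ge0 // NE0 divfK //; exact: lt0r_neq0.
Qed.


(** Complete the square in [t]. Describing [A] by membership lets the lemma serve for a point and a
    line as well as for two parallel lines. *)
Lemma inf_line w u (A : set R) : u != 0 ->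
  (forall y : R, A y <-> exists t, y = euclidean_norm (w + t *: u)) ->
  inf A = Num.sqrt (dot w w - dot w u ^+ 2 / dot u u).
Proof.
move=> u0 AP; have a0 : 0 < dot u u by rewrite dot_gt0.
have NE t : dot (w + t *: u) (w + t *: u) =
    dot w w - dot w u ^+ 2 / dot u u + (t * dot u u + dot w u) ^+ 2 / dot u u.
  by rewrite !dotE (dotC u w); field; rewrite lt0r_neq0.
apply: inf_attained.
  apply/AP; exists (- dot w u / dot u u); rewrite euclidean_normE NE; congr Num.sqrt.
  by field; rewrite lt0r_neq0.
move=> y /AP[t ->]; rewrite euclidean_normE ler_sqrt ?dot_ge0 // NE lerDl.
by rewrite divr_ge0 ?sqr_ge0 // ltW.
Qed.

Lemma cross_div w u : u != 0 -> cross w u = dot u u * (dot w w - dot w u ^+ 2 / dot u u).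
Proof. by move=> u0; rewrite /cross; field; rewrite dot_eq0. Qed.

Lemma dist_parallel p q u r : u != 0 -> dist (line p u) (line q u) = r ->
  cross (p - q) u = dot u u * r ^+ 2.
Proof.
move=> u0; rewrite /dist (@inf_line (p - q) u) // => [<-|y].
  rewrite sqr_sqrtr -?cross_div // -(pmulr_rge0 _ (_ : 0 < dot u u)) ?dot_gt0 //.
  by rewrite -cross_div // cross_ge0.
split=> [[_ [s _ <-] [_ [t _ <-] <-]]|[t ->]].
  exists (s - t); congr euclidean_norm.
  by rewrite opprD addrACA -scalerBl.
exists (p + t *: u); first by exists t.
exists (q + 0 *: u); first by exists 0.
by congr euclidean_norm; rewrite scale0r addr0 addrAC.
Qed.

Lemma cylinderP p u r x : u != 0 -> 0 < r ->
  cylinder (line p u) r x <-> cross (x - p) u <= dot u u * r ^+ 2.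
Proof.
move=> u0 r0; have a0 : 0 < dot u u by rewrite dot_gt0.
rewrite /cylinder /= /dist (@inf_line (x - p) u) // => [|y].
  have rE : r = Num.sqrt (r ^+ 2) by rewrite sqrtr_sqr ger0_norm // ltW.
  rewrite {1}rE ler_sqrt ?sqr_ge0 //.
  by rewrite cross_div // ler_pM2l.
split=> [[_ -> [_ [t _ <-] <-]]|[t ->]].
  by exists (- t); congr euclidean_norm; rewrite opprD addrA scaleNr.
exists x => //; exists (p - t *: u); first by exists (- t); rewrite ?scaleNr.
by congr euclidean_norm; rewrite opprD opprK addrA.
Qed.

Lemma crossC u v : cross u v = cross v u.
Proof. by rewrite /cross (dotC v u) mulrC. Qed.

Lemma exists_orthogonal v : (2 <= d)%N -> v != 0 -> exists2 u, u != 0 & dot u v = 0.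
Proof.
move=> d2 v0; have /existsP[i vi] : [exists i, v 0 i != 0].
  apply: contraR v0 => /existsPn v0; apply/eqP/rowP => i; rewrite mxE.
  by apply/eqP; have := v0 i; rewrite negbK.
have [j ji] : exists j, j != i.
  have : (0 < #|predC1 i|)%N by rewrite cardC1 card_ord; lia.
  by move=> /card_gt0P[j]; exists j.
exists (v 0 i *: delta_mx 0 j - v 0 j *: delta_mx 0 i).
  apply/eqP => /rowP/(_ j); rewrite !mxE !eqxx /= (negbTE ji) mulr1 mulr0 subr0.
  by move/eqP; rewrite (negbTE vi).
have dd k : dot (delta_mx 0 k) v = v 0 k.
  rewrite /dot (bigD1 k) //= mxE !eqxx mul1r big1 ?addr0 // => l /negbTE lk.
  by rewrite mxE eqxx lk mul0r.
by rewrite !dotE !dd; ring.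
Qed.

(* In the hyperplane orthogonal to [v], the ball of radius [r] around [p] reaches
   the distance [delta + r] from [q], where [delta] is the distance from [p] to [q]. *)
Lemma cylinder_sub p v r q w s : (2 <= d)%N -> v != 0 -> w != 0 -> 0 < r -> 0 < s ->
  cylinder (line p v) r `<=` cylinder (line q w) s ->
  line q w = line q v /\ Num.sqrt (cross (p - q) v / dot v v) + r <= s.
Proof.
move=> d2 v0 w0 r0 s0 sub; have a0 : 0 < dot v v by rewrite dot_gt0.
have b0 : 0 < dot w w by rewrite dot_gt0.
have an0 := lt0r_neq0 a0.
have [y yE] : exists y, y = p - q by exists (p - q).
have cvw : cross v w = 0.
  (* The first axis lies in the second cylinder. The resulting inequality is quadratic in [t] with
     nonnegative leading coefficient [cross v w], which must therefore vanish. *)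
  have quad t : t ^+ 2 * cross v w + 2 * t * (dot y v * dot w w - dot y w * dot v w) <=
      dot w w * s ^+ 2 - cross y w.
    have /sub/cylinderP : cylinder (line p v) r (p + t *: v).
      apply/cylinderP => //; rewrite addrC addKr /cross !dotE.
      by rewrite [leLHS](_ : _ = 0) ?mulr_ge0 ?sqr_ge0 ?ltW //; ring.
    move=> /(_ w0 s0); rewrite addrAC -yE /cross !dotE (dotC v y) => le.
    by rewrite -subr_ge0; rewrite -subr_ge0 in le; apply: le_trans le _; rewrite le_eqVlt; apply/orP; left; apply/eqP; ring.
  apply/eqP; rewrite eq_le cross_ge0 andbT leNgt; apply/negP => c0.
  move: quad; move: (dot y v * _ - _) (dot w w * s ^+ 2 - _) => K L quad.
  (* Adding the inequalities at [t] and [- t] removes the linear term. *)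
  have quad2 t : t ^+ 2 * cross v w <= L.
    by have := quad t; have := quad (- t); rewrite sqrrN mulrN mulNr; lra.
  pose t := 1 + `|L| / cross v w.
  have t1 : 1 <= t by rewrite lerDl divr_ge0 // ltW.
  have tc : t * cross v w = cross v w + `|L| by rewrite /t; field; rewrite lt0r_neq0.
  have := quad2 t; have := ler_norm L; rewrite expr2 -mulrA tc.
  move=> L1 L2; have : cross v w + `|L| <= t * (cross v w + `|L|).
    by rewrite ler_peMl // addr_ge0 // ltW.
  by lra.
have wE : w = (dot v w / dot v v) *: v.
  by rewrite mulrC -scalerA -cross_eq0 // scalerA mulVf // scale1r.
have lE : line q w = line q v.
  apply: (eq_line _ wE); last by exists 0; rewrite ?scale0r ?addr0.
  by apply: contraNneq w0 => cv; rewrite wE cv scale0r.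
split=> //; rewrite -yE; set delta := Num.sqrt _.
have delta0 : 0 <= delta by exact: sqrtr_ge0.
have dE : dot v v * delta ^+ 2 = cross y v.
  rewrite sqr_sqrtr ?divr_ge0 ?cross_ge0 ?ltW //; field.
  exact: an0.
(* [z] is the unit vector orthogonal to [v] pointing from the line through [q] towards [p]. When
   [delta = 0], any unit vector orthogonal to [v] works, and [2 <= d] provides one. *)
clearbody delta; have [z [zz zv zy]] : exists z, [/\ dot z z = 1, dot z v = 0 & dot z y = delta].
  have gg : dot (dot v v *: y - dot y v *: v) (dot v v *: y - dot y v *: v) =
      dot v v * cross y v by rewrite !dotE (dotC v y) /cross; ring.
  have [dz|dn0] := eqVneq delta 0.
    have [z z0 zv] := exists_orthogonal d2 v0.
    have zz0 : 0 < dot z z by rewrite dot_gt0.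
    exists ((Num.sqrt (dot z z))^-1 *: z); rewrite !dotE zv mulr0; split=> //.
      by rewrite mulrA -expr2 exprVn sqr_sqrtr ?ltW // mulVf // lt0r_neq0.
    have /eqP : dot (dot v v *: y - dot y v *: v) (dot v v *: y - dot y v *: v) = 0.
      by rewrite gg -dE dz expr0n !mulr0.
    rewrite dot_eq0 subr_eq0 => /eqP/(congr1 (dot z)); rewrite !dotZr zv mulr0.
    by move/eqP; rewrite mulf_eq0 (negbTE an0) /= dz => /eqP ->; rewrite mulr0.
  exists ((dot v v * delta)^-1 *: (dot v v *: y - dot y v *: v)).
  have -> : forall k, dot (k *: (dot v v *: y - dot y v *: v)) (k *: (dot v v *: y - dot y v *: v)) =
    k ^+ 2 * (dot v v * cross y v) by move=> k; rewrite dotZl dotZr gg; ring.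
  rewrite -dE !dotE (dotC v y); split.
  - by field; rewrite dn0 an0.
  - by field; rewrite dn0 an0.
  - transitivity ((dot v v * delta)^-1 * cross y v).
      by rewrite /cross; field; rewrite dn0 an0.
    by rewrite -dE; field; rewrite dn0 an0.
have /sub : cylinder (line p v) r (p + r *: z).
  by apply/cylinderP => //; rewrite addrC addKr /cross !dotE zz zv; lra.
rewrite lE => /(cylinderP _ _ v0 s0); rewrite addrAC -yE /cross !dotE zz zv (dotC y z) zy.
have -> : dot v v * s ^+ 2 = cross y v + dot v v * (s ^+ 2 - delta ^+ 2) by rewrite -dE; ring.
rewrite /cross => le.
have : dot v v * (delta + r) ^+ 2 <= dot v v * s ^+ 2 by lra.
by rewrite ler_pM2l // ler_sqr ?nnegrE ?addr_ge0 // ltW.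
Qed.

(** By the two inclusions, the distance between the parallel axes is at most both [r2 - r1] and
    [r1 - r2], hence zero. This identifies axes and radii that come from different existential
    statements. *)
Lemma cylinder_inj (L1 L2 : set 'rV[R]_d) (r1 r2 : R) : (2 <= d)%N ->
  is_line L1 -> is_line L2 -> 0 < r1 -> 0 < r2 ->
  cylinder L1 r1 = cylinder L2 r2 -> L1 = L2 /\ r1 = r2.
Proof.
move=> d2 [p [v [v0 ->]]] [q [w [w0 ->]]] r10 r20 cE; rewrite -!/(line _ _) in cE *.
have [lE le12] : line q w = line q v /\ _ := cylinder_sub d2 v0 w0 r10 r20 (subsetW cE).
rewrite lE in cE *.
have [_ le21] := cylinder_sub d2 v0 v0 r20 r10 (subsetW (esym cE)).
have := sqrtr_ge0 (cross (p - q) v / dot v v).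
have := sqrtr_ge0 (cross (q - p) v / dot v v) => s1 s2.
split; last by lra.
have /eqP : Num.sqrt (cross (p - q) v / dot v v) = 0 by lra.
rewrite sqrtr_eq0 pmulr_lle0 ?invr_gt0 ?dot_gt0 // => c0.
have {}c0 : cross v (p - q) = 0 by apply/eqP; rewrite eq_le cross_ge0 crossC c0.
apply/esym/(@eq_line _ _ _ _ 1); rewrite ?oner_eq0 ?scale1r //.
exists (dot v (p - q) / dot v v) => //.
rewrite mulrC -scalerA -cross_eq0 // scalerA mulVf ?dot_eq0 // scale1r.
by rewrite addrC subrK.
Qed.

End Euclid.

(** * Cylinders in coordinates *)

Section Parallel.
Local Open Scope ring_scope.
Variables (R : realType) (d : nat).

(** A [k] above [d + 2] leaves a nonzero [c] orthogonal to the [d] coordinate columns, the radii and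
    the all-one column of [M]. *)
Lemma parallel_bound k (P : 'I_k -> 'rV[R]_d) (r : 'I_k -> R) u : u != 0 ->
  (forall i, 0 < r i) ->
  (forall i j, i != j -> cross (P i - P j) u = dot u u * (r i + r j) ^+ 2) ->
  (k <= d.+2)%N.
Proof.
move=> u0 r0 PP; have a0 : 0 < dot u u by rewrite dot_gt0.
pose M1 := \matrix_(i < k, j < d) P i 0 j.
pose M := row_mx M1 (row_mx (\col_i r i) (const_mx 1 : 'cV[R]_k)).
rewrite leqNgt; apply/negP => dk.
have /rowV0Pn[c /sub_kermxP cM c0] : kermx M != 0.
  rewrite kermx_eq0 /row_free; apply/eqP => rk.
  by have := rank_leq_col M; rewrite rk; lia.
move: cM; rewrite !mul_mx_row -[X in _ = X](@row_mx0 _ 1 d (1 + 1)) => /eq_row_mx[cP].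
rewrite -[X in _ = X](@row_mx0 _ 1 1 1) => /eq_row_mx[cr c1].
have {}cP x : \sum_j c 0 j * dot x (P j) = 0.
  under eq_bigr do rewrite /dot big_distrr /=.
  rewrite exchange_big big1 //= => i _.
  have /rowP/(_ i) := cP; rewrite !mxE => cPi.
  transitivity (x 0 i * \sum_j c 0 j * M1 j i); last by rewrite cPi mulr0.
  by rewrite big_distrr; apply: eq_bigr => j _ /=; rewrite mxE; ring.
have {}cr : \sum_j c 0 j * r j = 0.
  have /rowP/(_ 0) := cr; rewrite !mxE => crE; rewrite -[RHS]crE.
  by apply: eq_bigr => j _; rewrite mxE.
have {}c1 : \sum_j c 0 j = 0.
  have /rowP/(_ 0) := c1; rewrite !mxE => c1E; rewrite -[RHS]c1E.
  by apply: eq_bigr => j _; rewrite mxE mulr1.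
pose A i := cross (P i) u - dot u u * r i ^+ 2.
pose T i j := cross (P i - P j) u - dot u u * (r i + r j) ^+ 2.
have TE i j : T i j = A i + A j - 2 * (dot u u * dot (P i) (P j)
    - dot (P i) u * dot u (P j) + dot u u * r i * r j).
  by rewrite /T /A /cross !dotE (dotC (P j) (P i)) (dotC u (P j)); ring.
(* Summed against [c], everything in [T i j] except [A j] vanishes, so the sum does not depend on
   [i]. *)
have cT i : \sum_j c 0 j * T i j = \sum_j c 0 j * A j.
  pose E j := c 0 j * A i - 2 * dot u u * (c 0 j * dot (P i) (P j))
    + 2 * dot (P i) u * (c 0 j * dot u (P j)) - 2 * dot u u * r i * (c 0 j * r j).
  rewrite (eq_bigr (fun j => E j + c 0 j * A j)); last first.
    by move=> j _; rewrite TE /E; ring.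
  rewrite big_split /= {}/E !big_split /= !sumrN -big_distrl -!big_distrr /=.
  by rewrite !cP cr c1; ring.
have cT' i : \sum_j c 0 j * T i j = c 0 i * (- 4 * dot u u * r i ^+ 2).
  rewrite (bigD1 i) //= big1 ?addr0 => [|j ji].
    by rewrite /T subrr /cross -(scale0r u) !dotE; ring.
  by rewrite /T PP 1?eq_sym // subrr mulr0.
(* Pair the two values of this sum with [c]: the one independent of [i] vanishes by [c1], the other
   gives a definite form. *)
have : \sum_i c 0 i ^+ 2 * (4 * dot u u * r i ^+ 2) = 0.
  rewrite (eq_bigr (fun i => - (c 0 i * \sum_j c 0 j * A j))); last first.
    by move=> i _; rewrite -(cT i) cT'; ring.
  by rewrite sumrN -big_distrl c1 /= mul0r oppr0.
have pos i : 0 < 4 * dot u u * r i ^+ 2 by rewrite !mulr_gt0 // exprn_gt0.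
move/eqP; rewrite psumr_eq0 => [/allP cz|i _]; last by rewrite mulr_ge0 ?sqr_ge0 // ltW.
case/eqP: c0; apply/rowP => i; rewrite mxE; apply/eqP.
have := cz i (mem_index_enum i); rewrite mulf_eq0 (gt_eqF (pos i)) orbF.
by rewrite expf_eq0.
Qed.

End Parallel.

Section Gram.
Local Open Scope ring_scope.
Variables (R : realType) (d : nat).
Implicit Types u v w p q : 'rV[R]_d.

Lemma gramC p q u v : gram (p - q) u v = gram (q - p) v u.
Proof.
rewrite -(opprB q p) /gram (crossC u v) !dotE (dotC v u); ring.
Qed.

(** Two lines are no farther apart than their base points. *)
Lemma gram_le w u v : u != 0 -> gram w u v <= dot w w * cross u v.
Proof.
move=> u0; rewrite -subr_ge0 -(pmulr_rge0 _ (_ : 0 < dot u u)) ?dot_gt0 //.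
have -> : dot u u * (dot w w * cross u v - gram w u v) =
   (dot u u * dot w v - dot u v * dot w u) ^+ 2 + dot w u ^+ 2 * cross u v.
  by rewrite /gram /cross; ring.
by rewrite addr_ge0 ?sqr_ge0 // mulr_ge0 ?sqr_ge0 ?cross_ge0.
Qed.

End Gram.

(** * Coordinates for lines transverse to a hyperplane *)

Section Chart.
Local Open Scope classical_set_scope.
Local Open Scope ring_scope.
Variables (R : realType) (m : nat) (t : R).
Local Notation I := (option ('I_m + 'I_m)).
Local Notation space := (prod_topology (fun _ : I => R)).

(** With the powers of one number as coefficients, a single [t] can give finitely many nonzero
    vectors nonzero heights. *)
Definition height (x : 'rV[R]_m.+1) : R := \sum_(i < m.+1) x 0 i * t ^+ i.

Definition embed (a : 'I_m -> R) : 'rV[R]_m.+1 :=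
  \row_i if unlift ord0 i is Some k then a k else - \sum_k a k * t ^+ k.+1.

Lemma embed_lift a k : embed a 0 (lift ord0 k) = a k.
Proof. by rewrite mxE liftK. Qed.

Lemma height_embed a : height (embed a) = 0.
Proof.
rewrite /height big_ord_recl mxE unlift_none expr0 mulr1 addrC.
by under eq_bigr do rewrite embed_lift; rewrite subrr.
Qed.

Lemma heightD x y : height (x + y) = height x + height y.
Proof. by rewrite -big_split; apply: eq_bigr => i _; rewrite mxE mulrDl. Qed.

Lemma heightZ a x : height (a *: x) = a * height x.
Proof. by rewrite /height big_distrr; apply: eq_bigr => i _; rewrite mxE /= mulrA. Qed.

Lemma embed_coord x : height x = 0 -> embed (fun k => x 0 (lift ord0 k)) = x.
Proof.
move=> hx; apply/rowP => i; rewrite mxE; case: unliftP => [k ->//|->].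
by move: hx; rewrite /height big_ord_recl expr0 mulr1 => /eqP; rewrite addr_eq0 => /eqP.
Qed.

(** In the index type, [inl] stands for the base point of height zero, [inr] for the direction of
    height one, and [None] for the radius. *)
Definition base (z : I -> R) := embed (fun k => z (Some (inl k))).
Definition dir (z : I -> R) : 'rV[R]_m.+1 := delta_mx 0 0 + embed (fun k => z (Some (inr k))).

Lemma height_delta : height (delta_mx 0 0) = 1.
Proof.
rewrite /height (bigD1 0) //= mxE !eqxx expr0 mul1r big1 ?addr0 // => i /negbTE i0.
by rewrite mxE i0 andbF mul0r.
Qed.

Lemma height_dir z : height (dir z) = 1.
Proof. by rewrite heightD height_embed height_delta addr0. Qed.

Lemma dir_neq0 z : dir z != 0.
Proof.
apply/eqP => d0; have := height_dir z; rewrite d0 -(scale0r (0 : 'rV_m.+1)) heightZ mul0r.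
by move/esym/eqP; rewrite oner_eq0.
Qed.

(** Slide the base point along the line to height zero and rescale the direction to height one. *)
Lemma chart (p v : 'rV[R]_m.+1) r : height v != 0 ->
  exists z, line (base z) (dir z) = line p v /\ z None = r.
Proof.
move=> hv; have [u uE] : exists u, u = (height v)^-1 *: v by exists ((height v)^-1 *: v).
have [q qE] : exists q, q = p + - height p *: u by exists (p + - height p *: u).
have hu : height u = 1 by rewrite uE heightZ mulVf.
have hq : height q = 0 by rewrite qE heightD heightZ hu; ring.
exists (fun i => match i with
  | None => r | Some (inl k) => q 0 (lift ord0 k)
  | Some (inr k) => (u - delta_mx 0 0) 0 (lift ord0 k) end).
split=> //; rewrite /base /dir /= embed_coord // embed_coord; last first.
  by rewrite heightD -scaleN1r heightZ hu height_delta; ring.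
rewrite addrC subrK; apply/esym/(@eq_line _ _ _ _ _ _ (height v)) => //.
  by rewrite uE scalerA mulfV // scale1r.
exists (- height p / height v) => //; rewrite qE uE scalerA; congr (_ + _ *: _).
Qed.

(** The tangency equation, squared and cleared of its denominator; it vanishes automatically for
    parallel directions, in particular on the diagonal. *)
Definition touching (z w : I -> R) : R :=
  gram (base z - base w) (dir z) (dir w) -
  (z None + w None) ^+ 2 * cross (dir z) (dir w).

Lemma touchingC z w : touching z w = touching w z.
Proof. by rewrite /touching gramC crossC (addrC (z None)). Qed.

Lemma pdeg_dot a b (u v : (I -> R) -> 'rV[R]_m.+1) :
  (forall i, pdeg a (fun z => u z 0 i)) -> (forall i, pdeg b (fun z => v z 0 i)) ->
  pdeg (a + b) (fun z => dot (u z) (v z)).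
Proof. by move=> ua vb; apply: pdeg_sum => i _; apply: pdegM. Qed.

Lemma pdeg_embed (f : 'I_m -> I) i : pdeg 1 (fun z : I -> R => embed (z \o f) 0 i).
Proof.
case: (unliftP ord0 i) => [k ->|->].
  by apply: (eq_pdeg _ (pdeg_coord R (f k))) => z; rewrite embed_lift.
apply: (@eq_pdeg _ _ _ (fun z => - \sum_k z (f k) * t ^+ k.+1)).
  by move=> z; rewrite mxE unlift_none.
apply: pdegN; apply: pdeg_sum => k _.
by have := pdegM (pdeg_coord R (f k)) (pdeg_cst _ 0 (t ^+ k.+1)).
Qed.

Lemma pdeg_base w i : pdeg 1 (fun z => (base z - w) 0 i).
Proof.
apply: (@eq_pdeg _ _ _ (fun z => base z 0 i - w 0 i)); first by move=> z; rewrite !mxE.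
by apply: pdegB; [exact: (pdeg_embed (fun k => Some (inl k)))|exact: pdeg_cst].
Qed.

Lemma pdeg_dir i : pdeg 1 (fun z => dir z 0 i).
Proof.
apply: (@eq_pdeg _ _ _ (fun z => delta_mx 0 0 0 i + embed (z \o (fun k => Some (inr k))) 0 i)).
  by move=> z; rewrite [RHS]mxE.
by apply: pdegD; [exact: pdeg_cst|exact: pdeg_embed].
Qed.

Lemma pdeg_touching w : pdeg 4 (touching^~ w).
Proof.
have bd := pdeg_base (base w); have dd := pdeg_dir.
have cd i : pdeg 0 (fun _ : I -> R => dir w 0 i) by exact: pdeg_cst.
have bb := pdeg_dot bd bd; have bdz := pdeg_dot bd dd; have bdw := @pdeg_dot 1 0 _ (fun=> dir w) bd cd.
have zz := pdeg_dot dd dd; have zw := @pdeg_dot 1 0 _ (fun=> dir w) dd cd.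
have ww := @pdeg_dot 0 0 (fun=> dir w) (fun=> dir w) cd cd.
have cr : pdeg 2 (fun z => cross (dir z) (dir w)).
  by apply: pdegB; [exact: pdegM zz ww|exact: pdegX 2 zw].
apply: pdegB; last first.
  apply: (pdegM (k := 2) _ cr); apply: (pdegX (k := 1) 2).
  by apply: pdegD; [exact: pdeg_coord|exact: pdeg_cst].
apply: pdegD.
  apply: pdegB; last exact: pdegM (pdegX 2 bdw) zz.
  by apply: pdegB; [exact: pdegM bb cr|exact: pdegM (pdegX 2 bdz) ww].
exact: pdegM (pdegM (pdegM (pdeg_cst _ 0 2) bdz) bdw) zw.
Qed.

(** Close to [z0] the base points are nearer to each other than [z0 None], hence than the sum of the
    radii. By [gram_le] the equation then forces parallel directions, and these coincide because
    both have height one. *)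
Lemma touching_near (z0 : space) : 0 < z0 None ->
  \forall z \near z0, touching z z0 = 0 -> forall k, z (Some (inr k)) = z0 (Some (inr k)).
Proof.
move=> r0.
have := @pdeg_gt_near R _ 1 (fun z => z None) z0 0 (pdeg_coord R None) r0.
have bd := pdeg_base (base z0).
have fd : pdeg 2 (fun z => z0 None ^+ 2 - dot (base z - base z0) (base z - base z0)).
  by apply: pdegB; [exact: pdeg_cst|exact: (@pdeg_dot 1 1)].
have := @pdeg_gt_near R _ 2 _ z0 0 fd.
rewrite subrr -(scale0r (0 : 'rV_m.+1)) dotZl mul0r subr0 exprn_gt0 // => /(_ isT).
apply: (@filterS2 _ _ (nbhs_filter z0)) => z; rewrite subr_gt0 => near0 rz /eqP.
rewrite /touching subr_eq0 => /eqP gE.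
have gle := gram_le (base z - base z0) (dir z0) (dir_neq0 z).
have c0 : cross (dir z) (dir z0) = 0.
  apply/eqP; rewrite eq_le cross_ge0 andbT leNgt; apply/negP => c0.
  move: gle; rewrite gE ler_pM2r // => gle.
  have : (z0 None) ^+ 2 < (z None + z0 None) ^+ 2.
    by rewrite ltr_sqr ?nnegrE ?ltrDr // ?addr_ge0 // ltW.
  by move=> near1; have := lt_le_trans (lt_trans near0 near1) gle; rewrite ltxx.
have dE := cross_eq0 c0; have := congr1 height dE; rewrite !heightZ !height_dir !mulr1 => ac.
move: dE; rewrite -ac => /(scalerI _); rewrite dot_eq0 => /(_ (dir_neq0 z)) dE k.
have /rowP/(_ (lift ord0 k)) := dE; rewrite ![in X in X -> _]mxE /= !liftK !add0r.
by [].
Qed.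


Lemma touching_diag z : touching z z = 0.
Proof. by rewrite /touching /gram subrr -(scale0r (dir z)) !dotE /cross; ring. Qed.

Lemma directions_bound n (x : 'I_n -> I -> R) :
  (forall i, 0 < x i None) ->
  (forall i j, i != j ->
    dist (line (base (x i)) (dir (x i))) (line (base (x j)) (dir (x j))) =
    x i None + x j None) ->
  (forall i j, i != j -> exists k, x i (Some (inr k)) != x j (Some (inr k))) ->
  (n <= 9 * 7 ^ (m + m))%N.
Proof.
move=> x0 xd xk.
pose U := [pred i : I | if i is Some (inr _) then true else false].
have := @separated_zeros R I None U isT touching n x pdeg_touching.
rewrite card_option card_sum !card_ord; apply=> //.
- by move=> z; apply: (eq_pdeg _ (pdeg_touching z)) => w; rewrite touchingC.
- move=> i j; have [->|ij] := eqVneq i j; first exact: touching_diag.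
  by rewrite /touching (dist_line _ _ (xd i j ij)) ?dir_neq0 // subrr.
- by move=> i j /xk[k xij]; exists (Some (inr k)).
move=> z0 z00; have := touching_near z00.
by apply: (@filterS _ _ (nbhs_filter z0)) => z zP /zP zk [[k|k]|] //= _.
Qed.

End Chart.

(** * From directions and parallel classes to the final bound *)

Section Final.
Local Open Scope ring_scope.
Local Open Scope classical_set_scope.
Variables (R : realType).

(** [height t (v i)] is the value at [t] of a nonzero polynomial; [t] avoids the roots of the
    product. *)
Lemma exists_height n m (v : 'I_n -> 'rV[R]_m.+1) :
  (forall i, v i != 0) -> exists t, forall i, height t (v i) != 0.
Proof.
move=> v0.
pose P i := \sum_(k < m.+1) v i 0 k *: 'X^k : {poly R}.
have PE i t : (P i).[t] = height t (v i).
  by rewrite horner_sum; apply: eq_bigr => k _; rewrite hornerZ hornerXn.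
have P0 i : P i != 0.
  apply: contraNneq (v0 i) => Pi; apply/eqP/rowP => k; rewrite mxE.
  have := congr1 (fun p : {poly R} => p`_k) Pi; rewrite coef0 coef_sum.
  rewrite (bigD1 k) //= coefZ coefXn eqxx mulr1 big1 ?addr0 // => l lk.
  by rewrite coefZ coefXn eq_sym (_ : (l == k :> nat) = false) ?mulr0 //; apply/negbTE.
have [t [_ _ nr]] : exists t, [/\ 0 < t, t < 1 & ~~ root (\prod_i P i) t].
  by apply: nonroot_between => //; apply/prodf_neq0 => i _.
exists t => i; apply: contra nr => /eqP h0.
by rewrite rootE horner_prod (bigD1 i) //= PE h0 mul0r.
Qed.

Lemma card_fibers (n a b : nat) (s : 'I_n -> 'I_n) :
  (forall i, s (s i) = s i) -> (#|[set i | s i == i]%SET| <= a)%N ->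
  (forall i, #|[set j | s j == i]%SET| <= b)%N -> (n <= a * b)%N.
Proof.
move=> ss Da Fb; rewrite -[n]card_ord -sum1_card.
rewrite (partition_big s (mem [set i | s i == i]%SET)) /= => [|i _]; last by rewrite inE ss.
apply: (@leq_trans (\sum_(j in [set i | s i == i]%SET) b)).
  apply: leq_sum => j _; apply: leq_trans (Fb j).
  by rewrite sum1_card; apply: eq_leq; apply: eq_card => i; rewrite !inE.
by rewrite sum_nat_const leq_mul2r Da orbT.
Qed.

(** Representatives of the directions are counted by [directions_bound], each parallel class by
    [parallel_bound] in dimension [m.+1]. *)
Lemma touching_lines_bound m n (p v : 'I_n -> 'rV[R]_m.+1) (r : 'I_n -> R) :
  (forall i, v i != 0) -> (forall i, 0 < r i) ->
  (forall i j, i != j -> dist (line (p i) (v i)) (line (p j) (v j)) = r i + r j) ->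
  (n <= 9 * 7 ^ (m + m) * m.+3)%N.
Proof.
move=> v0 r0 pv; have [t tv] := exists_height v0.
have /choice[x xP] i := chart (p i) (r i) (tv i).
have xd i j : i != j -> dist (line (base t (x i)) (dir t (x i)))
    (line (base t (x j)) (dir t (x j))) = x i None + x j None.
  by move=> ij; rewrite (xP i).1 (xP j).1 (xP i).2 (xP j).2 pv.
have x0 i : 0 < x i None by rewrite (xP i).2.
pose u i := [ffun k => x i (Some (inr k))] : {ffun 'I_m -> R}.
(* The search succeeds because [i] is a candidate, so the result depends on [u i] only. *)
pose s i := odflt i [pick j | u j == u i].
have us i : u (s i) = u i.
  by rewrite /s; case: pickP => [j /eqP //|/(_ i)]; rewrite eqxx.
have su i j : u i = u j -> s i = s j.
  move=> uij; rewrite /s uij; case: pickP => [//|/(_ j)]; by rewrite eqxx.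
apply: (@card_fibers _ _ _ s) => [i||i]; first exact: su.
- pose e (k : 'I_#|[set i | s i == i]%SET|) := enum_val k.
  apply: (@directions_bound R m t _ (x \o e)) => [k|k l kl|k l kl] /=; first exact: x0.
    by apply: xd; rewrite (inj_eq enum_val_inj).
  have : u (e k) != u (e l).
    apply: contra kl => /eqP/su; have := enum_valP k; have := enum_valP l.
    by rewrite !inE => /eqP -> /eqP ->; move/enum_val_inj ->.
  apply: contraNP => nk; apply/eqP/ffunP => a; rewrite !ffunE; apply/eqP.
  by apply/negPn/negP => xa; apply: nk; exists a.
pose e (k : 'I_#|[set j | s j == i]%SET|) := enum_val k.
have dirE k : dir t (x (e k)) = dir t (x i).
  have sk : s (e k) = i by have := enum_valP k; rewrite inE => /eqP.
  have /ffunP uk : u (e k) = u i by rewrite -(us (e k)) sk.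
  by congr (_ + embed t _); apply/funext => a; have := uk a; rewrite !ffunE.
apply: (@parallel_bound R m.+1 _ (fun k => base t (x (e k))) (fun k => x (e k) None)
  (dir t (x i))) => [||k l kl]; [exact: dir_neq0|by move=> k; exact: x0|].
apply: dist_parallel; first exact: dir_neq0.
rewrite -{1}(dirE k) -(dirE l); apply: xd.
by rewrite (inj_eq enum_val_inj).
Qed.

Lemma card_le_or_inj (T : Type) (C : set T) n :
  (C #<= `I_n)%card \/ exists2 f : 'I_n.+1 -> T, injective f & forall i, C (f i).
Proof.
have [Cn|Cn] := boolP (C #<= `I_n)%card; [by left|right].
have {Cn} : (`I_n.+1 #<= C)%card.
  have [/finite_setP[k Ck]|/infiniteP] := pselect (finite_set C).
    move: Cn; rewrite (card_le_eql Ck) (card_le_eqr Ck) !card_le_II; lia.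
  by apply: card_le_trans; exact: subset_card_le.
move=> /card_leP[f].
exists (fun i => val (f (ordII i))) => [|i]; last exact: set_valP.
move=> i j /val_inj fij; apply: (can_inj ordIIK).
by apply: (in2TT 'inj_f).
Qed.

End Final.

Theorem theorem1p2 (R : realType) (d : nat) (hd : (2 <= d)%N)
    (C : set (set 'rV[R]_d))
    (hcyl : forall A : set 'rV[R]_d, C A -> is_cylinder A)
    (htouch : mutually_touching C) :
  (C #<= `I_(20 * (d + 1) * 7 ^ (2 * d - 2)))%card.
Proof.
(* Otherwise there is one distinct cylinder more than claimed, whence the strict inequality
   below. *)
have [//|[A Ainj AC]] := card_le_or_inj C (20 * (d + 1) * 7 ^ (2 * d - 2)).
case: d hd C hcyl htouch A Ainj AC => [//|m] hd C hcyl htouch A Ainj AC.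
have /choice[w wP] i : exists w : 'rV[R]_m.+1 * 'rV[R]_m.+1 * R,
    [/\ w.1.2 != 0%R, (0 < w.2)%R & A i = cylinder (line w.1.1 w.1.2) w.2].
  by have [_ [r [[p [v [v0 ->]]] r0 ->]]] := hcyl _ (AC i); exists (p, v, r).
have w0 i : (0 < (w i).2)%R by have [] := wP i.
have v0 i : (w i).1.2 != 0%R by have [] := wP i.
have isl i : is_line (line (w i).1.1 (w i).1.2) by exists (w i).1.1, (w i).1.2.
have := @touching_lines_bound R m _ (fun i => (w i).1.1) (fun i => (w i).1.2)
  (fun i => (w i).2) v0 w0.
move=> bound; have {bound} : 20 * (m.+1 + 1) * 7 ^ (2 * m.+1 - 2) < 9 * 7 ^ (m + m) * m.+3.
  apply: bound.
  move=> i j ij; have [] := htouch _ _ (AC i) (AC j).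
    by move=> /Ainj/eqP; rewrite (negbTE ij).
  move=> L1 [L2 [r1 [r2 [[l1 r10 E1] [[l2 r20 E2] dE]]]]].
  have [_ _ Ei] := wP i; have [_ _ Ej] := wP j.
  have [<- <-] := cylinder_inj hd l1 (isl i) r10 (w0 i) (etrans (esym E1) Ei).
  by have [<- <-] := cylinder_inj hd l2 (isl j) r20 (w0 j) (etrans (esym E2) Ej).
have -> : 2 * m.+1 - 2 = m + m by lia.
have : 0 < 7 ^ (m + m) by rewrite expn_gt0.
(* [E] is positive and [9 * (m + 3) <= 20 * (m + 2)]. *)
by move: (7 ^ (m + m)) => E; nia.
Qed.
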